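(* Let $d\geq2$. For every choice of constants $c\in(0,\frac{d-1}{4})$, $T_0\geq1$ and $M\geq4$, there exists a positive constant $\delta_M$ (depending only on these quantities) as follows. Suppose that $\mu$ is a probability measure supported on a set $E\subseteq[0,1]^d$, whose $L^2$-Fourier integral obeys the growth condition $$\mathbb F_\mu(T_1T_2)\leq T_1^c\,\mathbb F_\mu(T_2)\quad\text{for all }T_1,T_2\geq T_0 .$$ If there exist $\delta\in(0,\delta_M)$ and a finite sequence $\{R_j:1\leq j\leq J\}\subseteq(T_0,\infty)$ satisfying $$R_{j+1}\geq\delta^{-2}R_j\quad\text{and}\quad\sum_{j=1}^J\mathbb F_\mu(R_j)>\Big(1-\frac2M\Big)\mathbb F_\mu\big(\delta^{-2}R_J\big),$$ then at least one of the points $\{\delta R_j^{-1}:1\leq j\leq J\}$ must lie in $\Delta(E)$.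
   Context: $\Delta(E)=\{|x-y|:x,y\in E\}$ is the distance set ($|\cdot|$ Euclidean norm). For a probability measure $\mu$ on $\mathbb R^d$, $\widehat\mu(\xi)=\int e^{-ix\cdot\xi}\,d\mu(x)$ and $\mathbb F_\mu(T)=\int_{|\xi|\leq T}|\widehat\mu(\xi)|^2\,d\xi$. The condition $R_{j+1}\geq\delta^{-2}R_j$ is required for $1\le j\le J-1$. *)

(* Defs.v *)
From HB Require Import structures.
From mathcomp Require Import all_boot all_order all_algebra.
From mathcomp Require Import all_classical all_reals all_analysis.
From mathcomp Require Import complex.

Set Implicit Arguments.
Unset Strict Implicit.
Unset Printing Implicit Defensive.

Import Order.TTheory GRing.Theory Num.Theory.
Import numFieldNormedType.Exports.
Local Open Scope classical_set_scope.
Local Open Scope complex_scope.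
Local Open Scope ring_scope.

(* Points of R^n are n-tuples, because tuples carry the product Borel
   sigma-algebra in the library (matrices carry none).  They have no vector
   space structure, hence the coordinatewise definitions below. *)
Notation Rn R n := (n.-tuple (measurableTypeR R)).

Section euclidean_space.
Context {R : realType} {n : nat}.
Implicit Types x y : Rn R n.

Definition coord x (i : 'I_n) : R := tnth x i.

Definition dotp x y : R := \sum_(i < n) coord x i * coord y i.

Definition enorm x : R := Num.sqrt (\sum_(i < n) coord x i ^+ 2).

Definition edist x y : R :=
  Num.sqrt (\sum_(i < n) (coord x i - coord y i) ^+ 2).

Definition unit_cube : set (Rn R n) :=
  [set x | forall i, 0 <= coord x i <= 1].

Definition distance_set (E : set (Rn R n)) : set R :=
  [set t | exists x y, [/\ E x, E y & t = edist x y]].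

End euclidean_space.

(* Lebesgue measure on R^n, as the n-fold product of the library's
   one-dimensional Lebesgue measure: the measure on R^(n+1) is transported
   from R * R^n along (a, x) |-> a :: x.  The lemma [lebesgue_Rn_box] gives
   its values on measurable boxes. *)
Section lebesgue_cons.
Context {R : realType} {n : nat}.
Variable m : {sigma_finite_measure set (Rn R n) -> \bar R}.

Definition cons_pair (p : measurableTypeR R * Rn R n) : Rn R n.+1 :=
  [tuple of p.1 :: p.2].

Lemma measurable_cons_pair : measurable_fun [set: _] cons_pair.
Proof. exact: (@measurable_cons _ _ _ _ fst n snd). Qed.

Definition lebesgue_cons : set (Rn R n.+1) -> \bar R :=
  pushforward (lebesgue_measure \x m)%E cons_pair.

Let lebesgue_cons0 : lebesgue_cons set0 = 0%E.
Proof. by rewrite /lebesgue_cons /pushforward preimage_set0 measure0. Qed.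

Let lebesgue_cons_ge0 A : (0 <= lebesgue_cons A)%E.
Proof. by rewrite /lebesgue_cons /pushforward; exact: measure_ge0. Qed.

Let lebesgue_cons_sigma_additive : semi_sigma_additive lebesgue_cons.
Proof.
move=> F mF tF mUF; rewrite /lebesgue_cons /pushforward preimage_bigcup.
have mpre A : measurable A -> measurable (cons_pair @^-1` A).
  by move=> mA; rewrite -[X in measurable X]setTI; exact: measurable_cons_pair.
apply: measure_semi_sigma_additive.
- by move=> k; exact: mpre.
- apply/trivIsetP => /= i j _ _ ij; rewrite -preimage_setI.
  by move/trivIsetP : tF => /(_ _ _ _ _ ij) ->//; rewrite preimage_set0.
- by rewrite -preimage_bigcup; exact: mpre.
Qed.

HB.instance Definition _ := isMeasure.Build _ _ _ lebesgue_cons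
  lebesgue_cons0 lebesgue_cons_ge0 lebesgue_cons_sigma_additive.

Let lebesgue_cons_sigma_finite : sigma_finite [set: _] lebesgue_cons.
Proof.
have /sigma_finiteP[F [TF ndF Foo]] := sigma_finiteT (@lebesgue_measure R).
have /sigma_finiteP[G [TG ndG Goo]] := sigma_finiteT m.
pose uncons (x : Rn R n.+1) : measurableTypeR R * Rn R n :=
  (thead x, [tuple of behead x]).
have muncons : measurable_fun [set: _] uncons.
  apply: measurable_fun_pair; first exact: measurable_tnth.
  exact: measurable_behead.
have unconsK p : uncons (cons_pair p) = p.
  by case: p => a x; congr pair; apply: val_inj.
exists (fun k => uncons @^-1` (F k `*` G k)).
  apply/esym; rewrite -subTset => x _.
  have [i _ Fi] : (\bigcup_k F k) (uncons x).1 by rewrite -TF.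
  have [j _ Gj] : (\bigcup_k G k) (uncons x).2 by rewrite -TG.
  exists (maxn i j) => //; split.
    by move: Fi; exact/subsetPset/ndF/leq_maxl.
  by move: Gj; exact/subsetPset/ndG/leq_maxr.
move=> k; have [mF Fkoo] := Foo k; have [mG Gkoo] := Goo k.
have mFG : measurable (F k `*` G k) by exact: measurableX.
split; first by rewrite -[X in measurable X]setTI; exact: muncons.
rewrite /lebesgue_cons /pushforward -comp_preimage.
rewrite (_ : uncons \o cons_pair = id); last exact/funext.
by rewrite preimage_id product_measure1E// lte_mul_pinfty// ge0_fin_numE.
Qed.

HB.instance Definition _ := Measure_isSigmaFinite.Build _ _ _ lebesgue_cons
  lebesgue_cons_sigma_finite.

End lebesgue_cons.

Fixpoint lebesgue_Rn (R : realType) (n : nat) :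
    {sigma_finite_measure set (Rn R n) -> \bar R} :=
  match n with
  | 0 => \d_([tuple] : Rn R 0)
  | n.+1 => lebesgue_cons (lebesgue_Rn R n)
  end.

Section fourier.
Context {R : realType} {n : nat}.
Variable mu : probability (Rn R n) R.

Definition cis (t : R) : R[i] := cos t +i* sin t.

Definition cintegral (f : Rn R n -> R[i]) : R[i] :=
  (\int[mu]_x complex.Re (f x)) +i* (\int[mu]_x complex.Im (f x)).

Definition fourier (xi : Rn R n) : R[i] :=
  cintegral (fun x => cis (- dotp x xi)).

(* Extended-real valued, so that no integrability is presupposed. *)
Definition fourier_energy (T : R) : \bar R :=
  (\int[lebesgue_Rn R n]_(xi in [set xi | (enorm xi <= T)%R])
     ((ComplexField.Normc.normc (fourier xi)) ^+ 2)%:E)%E.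

Definition measure_support : set (Rn R n) :=
  [set x | forall r : R, 0 < r -> (0 < mu [set y | (edist x y < r)%R])%E].

End fourier.

Lemma lebesgue_Rn_box (R : realType) (n : nat)
    (A : 'I_n -> set (measurableTypeR R)) :
  (forall i, measurable (A i)) ->
  lebesgue_Rn R n [set x | forall i, A i (tnth x i)] =
  (\prod_(i < n) lebesgue_measure (A i))%E.
Proof.
elim: n A => [|n IH] A mA.
  rewrite big_ord0 /= diracE mem_set//; by case.
rewrite big_ord_recl /= -IH; last by move=> i.
rewrite /lebesgue_cons /pushforward.
rewrite -product_measure1E//; last first.
  rewrite (_ : [set x | _] = \bigcap_(i in [set: 'I_n])
             ((fun x : Rn R n => tnth x i) @^-1` A (lift ord0 i))).
    apply: fin_bigcap_measurable => // i _.
    by rewrite -[X in measurable X]setTI; exact: measurable_tnth.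
  by apply/seteqP; split => x /= Ax i; [move=> _|]; exact: Ax.
congr ((_ \x _)%E _); apply/seteqP; split => -[a x] /=.
  move=> H; split; first by have := H ord0; rewrite tnth0.
  by move=> i; have := H (lift ord0 i); rewrite tnthS; congr (A _ _);
     rewrite (_ : [tuple of _] = x)//; apply: val_inj.
move=> [Aa Ax] i; case: (unliftP ord0 i) => [j ->|->].
  by rewrite tnthS; have := Ax j; congr (A _ _);
     rewrite (_ : [tuple of _] = x)//; apply: val_inj.
by rewrite tnth0.
Qed.

(* Main.v *)
Require Import Defs.
From HB Require Import structures.
From mathcomp Require Import all_boot all_order all_algebra.
From mathcomp Require Import all_classical all_reals all_analysis.
From mathcomp Require Import complex measurable_realfun ring lra.

Set Implicit Arguments.
Unset Strict Implicit.
Unset Printing Implicit Defensive.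

Import Order.TTheory GRing.Theory Num.Theory.
Import numFieldNormedType.Exports.
Local Open Scope classical_set_scope.
Local Open Scope ring_scope.

(** The distances between points of the support are probed with the uniform
    probability measure on the unit sphere of R^d.  Put n = d - 1.  Its
    Fourier transform is a radial function u(|xi|), here [radial n].  If t is
    not the distance of two points of E, then, the support of mu being compact,
    |x - y| stays away from t on it, so that the random vector x - y - t omega,
    with x and y drawn from mu and omega uniform on the sphere, stays away from
    the origin ([support_dist_gap], [enorm_chord_ge]).  This vector has Fourier
    transform |mu^(xi)|^2 u(t |xi|).  A law that gives no mass to a
    neighbourhood of the origin has, formally, a Fourier transform of integral
    zero; with a wide Gaussian weight of value 1 at the origin this becomes
    exact in the limit ([gauss_average_chord], [gauss_average_small]).

    Take t = delta / R and split the frequencies at R and at delta^-2 R.  Write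
    F for the energy of mu in a ball of given radius.
    - For |xi| <= R the argument t |xi| is at most delta, and
      u >= 1 - delta since u is 1-Lipschitz and u(0) = 1 ([radial_ge_sub]).
    - For R < |xi| <= delta^-2 R only a lower bound for u is available, but the
      uniform bound u >= -0.46 is enough ([radial_ge]).  For d = 2 the function
      u is the Bessel function J_0, whose infimum is about -0.403.  The
      transform in dimension d + 1 averages values of the one in dimension d
      ([radial_ge_average]), so that the bound for J_0 is inherited.
    - For |xi| > delta^-2 R the argument exceeds delta^-1, the decay
      |u(r)| <= L r^(-(d-1)/2) ([radial_decay]) meets the growth hypothesis on
      dyadic shells, and the contribution is at most a constant times
      delta^((d-1)/2 - 2c) F(R) ([dyadic_radial_tail]).  The hypothesis
      c < (d-1)/4 says precisely that this exponent is positive.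

    Since the total vanishes, the energy of the inner ball must be balanced by
    that of the annulus: for small delta, a scale R whose delta / R is not a
    distance satisfies
    0.96 F(R) <= 0.46 (F(delta^-2 R) - F(R))
    ([energy_gain_of_missing_distance]).  If this happens at every R_j, the
    lacunarity of the scales makes the annuli disjoint, so the gains on the
    right add up to at most F(delta^-2 R_J) ([sum_gain_le]).  Hence the sum of
    the F(R_j) is at most 46/96 times F(delta^-2 R_J), while it was assumed to
    exceed (1 - 2/M) F(delta^-2 R_J), and 1 - 2/M is at least 1/2.

    For the sphere, no surface measure is used: omega is built recursively in
    polar coordinates as (cos theta, sin theta omega'), theta having a density
    proportional to a power of sin, and u is the power series given by its
    moments; all bounds on u come from that series and from the Bessel equation
    u'' + (n / r) u' + u = 0. *)

(* Homonyms of these two names are imported after the definitions. *)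
Local Notation coord := Defs.coord.
Local Notation edist := Defs.edist.

(** * Euclidean geometry and measurability on tuples *)

Section euclid.
Context {R : realType} {d : nat}.
Implicit Types x y z : Rn R d.

Lemma measurable_coord (i : 'I_d) :
  measurable_fun [set: Rn R d] (fun x => coord x i).
Proof. exact: measurable_tnth. Qed.

Lemma cauchy_schwarz (a b : 'I_d -> R) :
  (\sum_i a i * b i) ^+ 2 <= (\sum_i a i ^+ 2) * (\sum_i b i ^+ 2).
Proof.
have : 0 <= \sum_i \sum_j (a i * b j - a j * b i) ^+ 2.
  by apply: sumr_ge0 => i _; apply: sumr_ge0 => j _; exact: sqr_ge0.
suff -> : \sum_i \sum_j (a i * b j - a j * b i) ^+ 2 =
    2 * ((\sum_i a i ^+ 2) * (\sum_i b i ^+ 2) - (\sum_i a i * b i) ^+ 2).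
  by rewrite pmulr_rge0// subr_ge0.
have prod_sum (f g : 'I_d -> R) :
    (\sum_i f i) * (\sum_j g j) = \sum_i \sum_j f i * g j.
  by rewrite big_distrlr.
transitivity ((\sum_i a i ^+ 2) * (\sum_i b i ^+ 2) +
    (\sum_i b i ^+ 2) * (\sum_i a i ^+ 2) -
    2 * ((\sum_i a i * b i) * (\sum_i a i * b i))); last by ring.
rewrite !prod_sum mulr_sumr -big_split -sumrB; apply: eq_bigr => i _.
rewrite mulr_sumr -big_split -sumrB; apply: eq_bigr => j _.
by rewrite /=; ring.
Qed.

Lemma enorm_ge0 x : 0 <= enorm x.
Proof. exact: sqrtr_ge0. Qed.

Lemma sqr_enorm x : enorm x ^+ 2 = \sum_i coord x i ^+ 2.
Proof. by rewrite sqr_sqrtr// sumr_ge0// => i _; exact: sqr_ge0. Qed.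

Lemma sum_le_sqrt (a b : 'I_d -> R) :
  \sum_i a i * b i <= Num.sqrt (\sum_i a i ^+ 2) * Num.sqrt (\sum_i b i ^+ 2).
Proof.
rewrite -sqrtrM; last by apply: sumr_ge0 => i _; exact: sqr_ge0.
rewrite (le_trans (ler_norm _))// -sqrtr_sqr ler_sqrt ?cauchy_schwarz//.
by rewrite mulr_ge0//; apply: sumr_ge0 => i _; exact: sqr_ge0.
Qed.

Lemma dotp_le x y : `|dotp x y| <= enorm x * enorm y.
Proof.
rewrite ler_norml; apply/andP; split; last exact: sum_le_sqrt.
rewrite lerNl -sumrN; have := sum_le_sqrt (fun i => - coord x i) (coord y).
under eq_bigr do rewrite mulNr.
by under [X in Num.sqrt X * _]eq_bigr do rewrite sqrrN.
Qed.

(** The triangle inequality for the Euclidean norm, stated for coordinate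
    families so that it applies to differences without naming their tuple. *)
Lemma minkowski2 (a b : 'I_d -> R) :
  Num.sqrt (\sum_i (a i + b i) ^+ 2) <=
  Num.sqrt (\sum_i a i ^+ 2) + Num.sqrt (\sum_i b i ^+ 2).
Proof.
have s0 (f : 'I_d -> R) : 0 <= \sum_i f i ^+ 2.
  by apply: sumr_ge0 => i _; exact: sqr_ge0.
rewrite -ler_sqr ?nnegrE ?addr_ge0 ?sqrtr_ge0//.
rewrite sqrrD !sqr_sqrtr//.
under eq_bigr do rewrite sqrrD.
rewrite !big_split/= lerD2r lerD2l.
by rewrite mulr2n lerD// sum_le_sqrt.
Qed.

Lemma edist_sym x y : edist x y = edist y x.
Proof. by congr Num.sqrt; apply: eq_bigr => i _; rewrite -sqrrN opprB. Qed.

Lemma edist_triangle y x z : edist x z <= edist x y + edist y z.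
Proof.
have := minkowski2 (fun i => coord x i - coord y i)
  (fun i => coord y i - coord z i).
by under eq_bigr do rewrite addrA subrK.
Qed.

Definition vscale (t : R) x : Rn R d := [tuple t * coord x i | i < d].

Lemma coord_mktuple (f : 'I_d -> R) i : coord (mktuple f) i = f i.
Proof. exact: tnth_mktuple. Qed.

Lemma enorm_vscale t x : enorm (vscale t x) = `|t| * enorm x.
Proof.
rewrite /enorm; under eq_bigr do rewrite coord_mktuple exprMn.
by rewrite -mulr_sumr sqrtrM ?sqr_ge0// sqrtr_sqr.
Qed.

Lemma dotpC x y : dotp x y = dotp y x.
Proof. by apply: eq_bigr => i _; rewrite mulrC. Qed.

Lemma dotp_vscale t x y : dotp (vscale t x) y = t * dotp x y.
Proof.
rewrite /dotp mulr_sumr; apply: eq_bigr => i _.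
by rewrite coord_mktuple mulrA.
Qed.

End euclid.

Section measurability.
Context {R : realType} {d : nat} {dT} {T : measurableType dT}.

Lemma measurable_dotp_fun (f g : T -> Rn R d) :
  measurable_fun [set: T] f -> measurable_fun [set: T] g ->
  measurable_fun [set: T] (fun x => dotp (f x) (g x)).
Proof.
move=> mf mg; apply: measurable_sum => i; apply: measurable_funM.
  exact: (measurableT_comp (measurable_coord i) mf).
exact: (measurableT_comp (measurable_coord i) mg).
Qed.

Lemma measurable_sqrt_fun (f : T -> R) : measurable_fun [set: T] f ->
  measurable_fun [set: T] (fun x => Num.sqrt (f x)).
Proof.
move=> mf; apply: (measurableT_comp _ mf).
exact: continuous_measurable_fun (@sqrt_continuous R).
Qed.

Lemma measurable_edist_fun (f g : T -> Rn R d) :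
  measurable_fun [set: T] f -> measurable_fun [set: T] g ->
  measurable_fun [set: T] (fun x => edist (f x) (g x)).
Proof.
move=> mf mg; apply: measurable_sqrt_fun; apply: measurable_sum => i.
apply: measurable_funX; apply: measurable_funB.
  exact: (measurableT_comp (measurable_coord i) mf).
exact: (measurableT_comp (measurable_coord i) mg).
Qed.

Lemma measurable_enorm_fun (f : T -> Rn R d) :
  measurable_fun [set: T] f -> measurable_fun [set: T] (fun x => enorm (f x)).
Proof.
move=> mf; apply: measurable_sqrt_fun; apply: measurable_sum => i.
apply: measurable_funX; exact: (measurableT_comp (measurable_coord i) mf).
Qed.

Lemma measurable_mktuple (f : 'I_d -> T -> R) :
  (forall i, measurable_fun [set: T] (f i)) ->
  measurable_fun [set: T] (fun x => [tuple f i x | i < d] : Rn R d).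
Proof.
move=> mf; apply/measurable_fun_tnthP => i.
apply: eq_measurable_fun (mf i) => x _; by rewrite /= tnth_mktuple.
Qed.

End measurability.

Section bounded_integrals.
Context {R : realType} {d1 d2} {T1 : measurableType d1} {T2 : measurableType d2}.

Lemma bounded_integrable (m : {finite_measure set T1 -> \bar R}) (f : T1 -> R)
    (K : R) :
  measurable_fun [set: T1] f -> (forall x, `|f x| <= K) ->
  m.-integrable [set: T1] (EFin \o f).
Proof.
move=> mf fK; apply: measurable_bounded_integrable => //.
  by rewrite ltey_eq fin_num_measure.
exists K; split; first exact: num_real.
by move=> M KM x _; exact: le_trans (fK x) (ltW KM).
Qed.

Lemma Rintegral_prod1 (m1 : {sigma_finite_measure set T1 -> \bar R})
    (m2 : {sigma_finite_measure set T2 -> \bar R}) (f : T1 * T2 -> R) :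
  (m1 \x m2)%E.-integrable setT (EFin \o f) ->
  (forall x, m2.-integrable setT (fun y => (f (x, y))%:E)) ->
  \int[m1]_x (\int[m2]_y f (x, y)) = \int[(m1 \x m2)%E]_z f z.
Proof.
move=> intf f2; congr fine; rewrite -integral12_prod_meas1//.
apply: eq_integral => x _; rewrite fineK//.
exact: integrable_fin_num.
Qed.

Lemma Rintegral_prod2 (m1 : {sigma_finite_measure set T1 -> \bar R})
    (m2 : {sigma_finite_measure set T2 -> \bar R}) (f : T1 * T2 -> R) :
  (m1 \x m2)%E.-integrable setT (EFin \o f) ->
  (forall y, m1.-integrable setT (fun x => (f (x, y))%:E)) ->
  \int[m2]_y (\int[m1]_x f (x, y)) = \int[(m1 \x m2)%E]_z f z.
Proof.
move=> intf f1; congr fine; rewrite -integral21_prod_meas1//.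
apply: eq_integral => y _; rewrite fineK//.
exact: integrable_fin_num.
Qed.

End bounded_integrals.

(** * Power series with rapidly decaying coefficients *)

Section series_bounds.
Context {R : realType}.
Implicit Types c : nat -> R.

Lemma is_cvg_pseries_le_exp c (x : R) :
  (forall k, `|c k| <= (k`!%:R)^-1) -> cvgn (pseries c x).
Proof.
move=> ck; apply: normed_cvg.
apply: (@series_le_cvg _ _ (exp_coeff `|x|)) => //= [k|k|].
- exact: exp_coeff_ge0.
- rewrite /exp_coeff/= normrM normrX mulrC ler_wpM2l// exprn_ge0//.
- exact: is_cvg_series_exp_coeff.
Qed.

(** Comparison with a geometric series of ratio 1/2: this turns partial sums
    into numerical approximations with an explicit error. *)
Lemma series_tail_le c (N : nat) : cvgn (series c) ->
  (forall k, (N <= k)%N -> `|c k.+1| <= `|c k| / 2) ->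
  `|limn (series c) - series c N| <= 2 * `|c N|.
Proof.
move=> cvc ratio.
have tail j : `|series c (N + j)%N - series c N| <=
    2 * `|c N| - 2 * `|c (N + j)%N|.
  elim: j => [|j IH]; first by rewrite addn0 !subrr normr0.
  rewrite addnS {1}/series/= big_nat_recr//= -/(series c (N + j)%N) addrAC.
  apply: (le_trans (ler_normD _ _)).
  have := ratio (N + j)%N (leq_addr _ _); move: IH; lra.
have : (`|series c n - series c N| @[n --> \oo]) -->
    `|limn (series c) - series c N|.
  by apply: cvg_norm; apply: cvgB => //; exact: cvg_cst.
move/cvgr_to_le; apply; near=> n.
have Nn : (N <= n)%N by near: n; exact: nbhs_infty_ge.
rewrite -(subnKC Nn); apply: (le_trans (tail _)).
by rewrite gerBl mulr_ge0.
Unshelve. all: end_near. Qed.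

(** Ratios bounded by those of the series of exp(x/2): this gives convergence
    everywhere, and it is stable under formal differentiation. *)
Definition exp_decaying c :=
  `|c 0%N| <= 1 /\ forall k, `|c k.+1| <= `|c k| / (k.+1%:R * 2).

Lemma exp_decaying_diffs c : exp_decaying c -> exp_decaying (pseries_diffs c).
Proof.
move=> [c0 ck]; split=> [|k].
  rewrite /pseries_diffs mul1r (le_trans (ck 0%N))// mul1r.
  by rewrite ler_pdivrMr// (le_trans c0)// mul1r ler1n.
rewrite /pseries_diffs !normrM !normr_nat.
apply: (le_trans (ler_wpM2l (ler0n R k.+2) (ck k.+1))).
rewrite le_eqVlt; apply/orP; left; apply/eqP; field.
have k0 : 0 <= k%:R :> R by [].
by apply/andP; split; apply: lt0r_neq0; lra.
Qed.

Lemma exp_decaying_cvg c (x : R) : exp_decaying c -> cvgn (pseries c x).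
Proof.
move=> [c0 ck]; apply: is_cvg_pseries_le_exp; elim=> [|k IH].
  by rewrite fact0 invr1.
apply: (le_trans (ck k)); rewrite factS natrM !invfM.
rewrite mulrC ler_pM ?mulr_ge0 ?invr_ge0//.
by rewrite ler_piMr ?invr_ge0// invf_le1// ler1n.
Qed.

Lemma exp_decaying_is_derive c (x : R) : exp_decaying c ->
  is_derive x (1 : R) (fun y => limn (pseries c y))
    (limn (pseries (pseries_diffs c) x)).
Proof.
move=> dc; have dc' := exp_decaying_diffs dc.
apply: (@pseries_snd_diffs _ _ (`|x| + 1)).
- exact: exp_decaying_cvg.
- exact: exp_decaying_cvg.
- exact/exp_decaying_cvg/exp_decaying_diffs.
- by rewrite [ltRHS]ger0_norm ?addr_ge0// ltrDl.
Qed.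

End series_bounds.

(** * The radial Bessel function of the sphere *)

Section radial.
Context {R : realType}.
Variable n : nat.

(** The coefficients, in powers of r^2, of the solution u with u(0) = 1 of
    u'' + (n / r) u' + u = 0.  It is the Fourier transform of the uniform
    measure on the unit sphere of R^(n+1), that is
    Gamma((n+1)/2) (2/r)^((n-1)/2) J_((n-1)/2)(r): the cosine for n = 0, the
    Bessel function J_0 for n = 1. *)
Fixpoint radial_coef (k : nat) : R :=
  if k is k'.+1 then
    - radial_coef k' / ((2 * k'%:R + 2) * (2 * k'%:R + n%:R + 1)) else 1.

Definition radial_series (s : R) := limn (pseries radial_coef s).
(* Derivatives with respect to s = r ^+ 2; in terms of r, the derivative of u
   is 2 r radial' r. *)
Definition radial_series' (s : R) :=
  limn (pseries (pseries_diffs radial_coef) s).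
Definition radial_series'' (s : R) :=
  limn (pseries (pseries_diffs (pseries_diffs radial_coef)) s).

Definition radial (r : R) := radial_series (r ^+ 2).

Let den k : 0 < (2 * k%:R + 2) * (2 * k%:R + n%:R + 1) :> R.
Proof. by rewrite mulr_gt0// ltr_wpDl// ?addr_ge0// mulr_ge0. Qed.

Lemma radial_coef_le k : `|radial_coef k.+1| <= `|radial_coef k| / (k.+1%:R * 2).
Proof.
rewrite /= normrM normrN normfV (gtr0_norm (den k)) ler_wpM2l//.
rewrite lef_pV2 ?posrE ?den ?mulr_gt0//.
have k0 : 0 <= k%:R :> R by [].
have n0 : 0 <= n%:R :> R by [].
by rewrite -natr1; nra.
Qed.

Lemma radial_coef_decaying : exp_decaying radial_coef.
Proof. by split; [rewrite normr1|exact: radial_coef_le]. Qed.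

Let decaying' := exp_decaying_diffs radial_coef_decaying.
Let decaying'' := exp_decaying_diffs decaying'.

Lemma radial_series_ode s :
  4 * s * radial_series'' s + 2 * n.+1%:R * radial_series' s
  + radial_series s = 0.
Proof.
have H2 := pseries_diffs_equiv (exp_decaying_cvg (x := s) decaying'').
have : series (fun k => 4 * s *
     (k%:R * pseries_diffs radial_coef k * s ^+ k.-1)
     + 2 * n.+1%:R * (pseries_diffs radial_coef k * s ^+ k)
     + radial_coef k * s ^+ k) @ \oo -->
   4 * s * radial_series'' s + 2 * n.+1%:R * radial_series' s + radial_series s.
  rewrite [X in X @ _ --> _](_ : _ =
    (4 * s) \*: series (fun k => k%:R * pseries_diffs radial_coef k * s ^+ k.-1) +
     (2 * n.+1%:R) \*: pseries (pseries_diffs radial_coef) s +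
     pseries radial_coef s).
    apply: cvgD; last exact: exp_decaying_cvg radial_coef_decaying.
    by apply: cvgD; apply: cvgZr => //; exact: exp_decaying_cvg decaying'.
  apply/funext => N; rewrite /series/= /pseries !fctE /=.
  by rewrite /series/= !big_split/= -!mulr_sumr.
rewrite [X in X @ _ --> _](_ : _ = cst 0).
  by move=> h; exact: (cvg_unique (@Rhausdorff R) h (cvg_cst _)).
apply/funext => N; rewrite /series/= big1// => k _.
have -> : 4 * s * (k%:R * pseries_diffs radial_coef k * s ^+ k.-1) =
   4 * k%:R * pseries_diffs radial_coef k * s ^+ k.
  by case: k => [|k]; [rewrite !(mulr0,mul0r)|rewrite exprS/=; ring].
rewrite /pseries_diffs /=.
rewrite -[n.+1%:R]natr1 -[k.+1%:R]natr1.
field.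
have k0 : 0 <= k%:R :> R by [].
have n0 : 0 <= n%:R :> R by [].
by apply/andP; split; apply: lt0r_neq0; lra.
Qed.

Definition radial' (r : R) := radial_series' (r ^+ 2).

Let is_derive_sqr_comp (f : R -> R) (df r : R) :
  is_derive (r ^+ 2) (1 : R) f df ->
  is_derive r (1 : R) (fun x => f (x ^+ 2)) (2 * r * df).
Proof.
move=> Df; rewrite mulrC; apply: is_derive1_comp; apply: is_derive_eq.
by rewrite /GRing.scale/=; ring.
Qed.

Lemma is_derive_radial r : is_derive r (1 : R) radial (2 * r * radial' r).
Proof.
exact/is_derive_sqr_comp/exp_decaying_is_derive/radial_coef_decaying.
Qed.

Lemma is_derive_radial' r : is_derive r (1 : R) radial'
  (2 * r * radial_series'' (r ^+ 2)).
Proof. exact/is_derive_sqr_comp/exp_decaying_is_derive/decaying'. Qed.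

Lemma radial_ode r : 2 * r * (2 * r * radial_series'' (r ^+ 2)) =
  - radial r - 2 * n.+1%:R * radial' r.
Proof.
have := radial_series_ode (r ^+ 2); rewrite /radial /radial' => h.
by apply/eqP; rewrite -subr_eq0 -[X in _ == X]h; apply/eqP; ring.
Qed.

Lemma radial0 : radial 0 = 1.
Proof.
rewrite /radial expr0n/= /radial_series.
have : pseries radial_coef 0 @ \oo --> (1 : R).
  rewrite -cvg_shiftS; apply: cvg_near_cst; apply: nearW => N.
  rewrite /pseries /series/= big_nat_recl//= expr0 mulr1 big1 ?addr0// => k _.
  by rewrite expr0n mulr0.
exact: cvg_lim.
Qed.

End radial.

Section energies.
Context {R : realType}.

Lemma is_derive_nincr (f f' : R -> R) (a : R) :
  (forall x, is_derive x (1 : R) f (f' x)) -> (forall x, a < x -> f' x <= 0) ->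
  forall x y, a <= x -> x <= y -> f y <= f x.
Proof.
move=> df f'0; apply: ler0_derive1_nincry.
- by move=> x _; exact: ex_derive.
- move=> x; rewrite in_itv/= andbT => ax.
  by rewrite derive1E derive_val f'0.
- by apply: derivable_within_continuous => x _; exact: ex_derive.
Qed.

(** The energy u^2 + u'^2 of the oscillator u'' + (n / r) u' + u = 0 is
    dissipated by the friction term: its derivative is -2 (n / r) u'^2. *)
Lemma radial_energy_nincr n (x y : R) : 0 <= x -> x <= y ->
  radial n y ^+ 2 + (2 * y * radial' n y) ^+ 2 <=
  radial n x ^+ 2 + (2 * x * radial' n x) ^+ 2.
Proof.
pose E (r : R) := radial n r ^+ 2 + (2 * r * radial' n r) ^+ 2.
pose E' (r : R) := - (8 * n%:R * r * radial' n r ^+ 2).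
apply: (@is_derive_nincr E E') => r.
  have D0 := is_derive_radial n r; have D1 := is_derive_radial' n r.
  have ode := radial_ode n r.
  apply: is_derive_eq; rewrite /GRing.scale/= /E' ode.
  by rewrite -[n.+1%:R]natr1; ring.
move=> r0; rewrite /E' oppr_le0 mulr_ge0 ?sqr_ge0// mulr_ge0 ?(ltW r0)//.
Qed.

(** Put n = m + 1.  Up to the factor r^(-n/2) the function u oscillates with
    bounded amplitude.  The natural amplitude r^n (u^2 + u'^2) is corrected by
    n r^(n-1) u u', which removes the leading term of its derivative; the
    remainder is absorbed by the decreasing factor 1 + 2n/r.  The product of
    these, H below, is nonincreasing for r >= 2n + 1 and controls u^2 r^n. *)
Lemma radial_decay m : exists K : R, 0 <= K /\ forall r : R,
  2 * m.+1%:R + 1 <= r -> radial m.+1 r ^+ 2 * r ^+ m.+1 <= K.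
Proof.
pose n : R := m.+1%:R.
pose U := radial (R := R) m.+1; pose W := radial' (R := R) m.+1.
pose P r := U r ^+ 2 + (2 * r * W r) ^+ 2 + 2 * n * (U r * W r).
pose P' r := - 8 * n * r * W r ^+ 2 + 2 * n * (2 * r * W r ^+ 2 +
      U r * (2 * r * radial_series'' m.+1 (r ^+ 2))).
pose H r := (r + 2 * n) * r ^+ m * P r.
pose H' r := r ^+ m * P r +
  (r + 2 * n) * (m%:R * r ^+ m.-1 * P r + r ^+ m * P' r).
have n0 : 0 < n by rewrite ltr0n.
have dH r : is_derive r (1 : R) H (H' r).
  have D0 := is_derive_radial m.+1 r; have D1 := is_derive_radial' m.+1 r.
  have ode := radial_ode m.+1 r.
  have DX : is_derive r (1 : R) (fun x => x ^+ m) (m%:R * r ^+ m.-1).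
    have -> : (fun x : R => x ^+ m) = id ^+ m by rewrite exprfctE.
    by apply: is_derive_eq; rewrite /GRing.scale/= mulr1.
  have DA : is_derive r (1 : R) (fun x => x + 2 * n) 1.
    by apply: is_derive_eq; rewrite addr0.
  have DP : is_derive r (1 : R) P (P' r).
    apply: is_derive_eq; rewrite /GRing.scale/= ode /P' -[m.+2%:R]natr1 -/n.
    by rewrite -/(U r) -/(W r); ring.
  apply: (is_derive_eq (is_deriveM (is_deriveM DA DX) DP)).
  by rewrite /GRing.scale/= !fctE /H'; ring.
have Hle r : 2 * n + 1 <= r -> H' r <= 0.
  move=> nr; have r0 : 0 < r by lra.
  rewrite -(pmulr_rle0 _ r0).
  have -> : r * H' r = - (2 * n * r ^+ m *
    (U r ^+ 2 + 4 * r ^+ 2 * W r ^+ 2 + (r + 4 * n) * (U r * W r))).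
    have rs : r * (2 * r * radial_series'' m.+1 (r ^+ 2)) =
        - (U r / 2) - (n + 1) * W r.
      by have := radial_ode m.+1 r; rewrite -[m.+2%:R]natr1 -/n -/(U r) -/(W r); lra.
    have rm : r * (m%:R * r ^+ m.-1) = m%:R * r ^+ m.
      by case: (m) => [|k]; [rewrite !mul0r mulr0|rewrite exprS/=; ring].
    have mn : m%:R = n - 1 by rewrite /n -natr1 addrK.
    transitivity (r * r ^+ m * P r + (r + 2 * n) *
      (r * (m%:R * r ^+ m.-1) * P r + r ^+ m *
        (- 8 * n * r ^+ 2 * W r ^+ 2 + 2 * n * (2 * r ^+ 2 * W r ^+ 2 +
         U r * (r * (2 * r * radial_series'' m.+1 (r ^+ 2))))))).
      by rewrite /H' /P'; ring.
    by rewrite rm rs mn /P; field.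
  rewrite oppr_le0 mulr_ge0 ?mulr_ge0 ?exprn_ge0 ?(ltW r0) ?(ltW n0)//.
  have sq0 : 0 <= (U r + (r + 4 * n) / 2 * W r) ^+ 2 by exact: sqr_ge0.
  have sq1 : 0 <= (4 * r ^+ 2 - ((r + 4 * n) / 2) ^+ 2) * W r ^+ 2.
    by rewrite mulr_ge0 ?sqr_ge0//; nra.
  by move: sq0 sq1; lra.
have PU r : 2 * n + 1 <= r -> U r ^+ 2 <= 2 * P r.
  move=> nr; have r0 : 0 < r by lra.
  have sq0 : 0 <= (U r + 2 * n * W r) ^+ 2 by exact: sqr_ge0.
  have sq1 : 0 <= (2 * r ^+ 2 - n ^+ 2) * W r ^+ 2.
    by rewrite mulr_ge0 ?sqr_ge0//; nra.
  by rewrite /P; move: sq0 sq1; lra.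
have PH r : 2 * n + 1 <= r -> U r ^+ 2 * r ^+ m.+1 <= 2 * H r.
  move=> nr; have r0 : 0 < r by lra.
  have P0 : 0 <= P r by rewrite -(pmulr_rge0 _ (ltr0n R 2)) (le_trans _ (PU _ nr))// sqr_ge0.
  rewrite /H [r ^+ m.+1]exprS; have a0 : 0 <= r ^+ m by rewrite exprn_ge0// ltW.
  have -> : 2 * ((r + 2 * n) * r ^+ m * P r) =
      (r + 2 * n) * (2 * P r * r ^+ m) by ring.
  have -> : U r ^+ 2 * (r * r ^+ m) = r * (U r ^+ 2 * r ^+ m) by ring.
  have n0' := ltW n0.
  apply: ler_pM; [exact: ltW|by rewrite mulr_ge0 ?sqr_ge0|by lra|].
  by rewrite ler_wpM2r ?PU.
exists (2 * H (2 * n + 1)); split=> [|r nr].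
  apply: le_trans (PH _ (lexx _)); rewrite mulr_ge0 ?sqr_ge0// exprn_ge0//; lra.
apply: (le_trans (PH _ nr)); rewrite ler_pM2l//.
apply: (@is_derive_nincr H H' (2 * n + 1)) => // x /ltW; exact: Hle.
Qed.

(** The usual series of J_0(2 sqrt x). *)
Lemma radial1_coefE k (x : R) :
  radial_coef 1 k * (4 * x) ^+ k = (- x) ^+ k / k`!%:R ^+ 2.
Proof.
elim: k => [|k IH]; first by rewrite !expr0 fact0 expr1n divr1 mulr1.
rewrite /= !exprSr mulrA.
rewrite (_ : _ * (4 * x) = - (radial_coef 1 k * (4 * x) ^+ k) * (4 * x) /
    ((2 * k%:R + 2) * (2 * k%:R + 1 + 1))); last by ring.
rewrite IH factS natrM -[k.+1%:R]natr1.
have k0 : 0 <= k%:R :> R by [].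
have f0 : k`!%:R != 0 :> R by rewrite pnatr_eq0 -lt0n fact_gt0.
field; rewrite f0 /=; apply/andP; split; apply: lt0r_neq0; lra.
Qed.

(* Radii up to 3 correspond to x = r^2 / 4 up to 9 / 4. *)
Lemma radial1_series_approx (x : R) : 0 <= x <= 9 / 4 ->
  `|radial_series 1 (4 * x) - (1 - x + x ^+ 2 / 4 - x ^+ 3 / 36
     + x ^+ 4 / 576)| <= 1 / 100.
Proof.
move=> /andP[x0 x9].
pose c k : R := (- x) ^+ k / k`!%:R ^+ 2.
have E : pseries (radial_coef 1) (4 * x) = series c.
  apply/funext => N; rewrite /pseries /series/=.
  by apply: eq_bigr => k _; exact: radial1_coefE.
have cvc : cvgn (series c).
  by rewrite -E; exact: exp_decaying_cvg (radial_coef_decaying 1).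
have := series_tail_le (N := 5) cvc.
rewrite /radial_series E [series c 5]/series/= !big_nat_recr//= big_geq//.
have -> : 0 + c 0%N + c 1%N + c 2%N + c 3%N + c 4%N =
    1 - x + x ^+ 2 / 4 - x ^+ 3 / 36 + x ^+ 4 / 576.
  by rewrite /c !factS fact0 /=; field.
have ratio k : (4 < k)%N -> `|c k.+1| <= `|c k| / 2.
  move=> k5; have -> : c k.+1 = c k * (- x / k.+1%:R ^+ 2).
    rewrite /c factS natrM exprSr; field.
    by rewrite nat1r !pnatr_eq0/= -lt0n fact_gt0.
  rewrite normrM ler_wpM2l// normf_div normrN ger0_norm// ger0_norm//.
  rewrite ler_pdivrMr ?exprn_gt0//.
  have : 5 ^+ 2 <= k.+1%:R ^+ 2 :> R by rewrite lerXn2r ?nnegrE// ler_nat ltnW.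
  lra.
move=> /(_ ratio) h; apply: (le_trans h).
have -> : `|c 5%N| = x ^+ 5 / 120 ^+ 2.
  have -> : c 5%N = - (x ^+ 5 / 120 ^+ 2) by rewrite /c !factS fact0 /=; field.
  by rewrite normrN ger0_norm ?divr_ge0 ?exprn_ge0 ?ler0n.
have : x ^+ 5 <= (9 / 4) ^+ 5 by rewrite lerXn2r ?nnegrE//; lra.
lra.
Qed.

Lemma radial1_series'_approx :
  `|radial_series' 1 (9 : R) - (- (1 / 4) + 9 / 32 - 81 / 768 + 81 / 4096)| <= 1 / 200.
Proof.
pose c k : R := - (- (9 / 4)) ^+ k / (4 * k.+1%:R * k`!%:R ^+ 2).
have E : pseries (pseries_diffs (radial_coef 1)) 9 = series c.
  apply/funext => N; rewrite /pseries /series/=.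
  apply: eq_bigr => k _; rewrite /pseries_diffs.
  have := radial1_coefE k.+1 (9 / 4).
  rewrite [4 * (9 / 4)](_ : _ = 9); last by field.
  rewrite !exprS factS natrM /c => h.
  have f0 : k`!%:R != 0 :> R by rewrite pnatr_eq0 -lt0n fact_gt0.
  apply: (mulfI (_ : 9 != 0 :> R)) => //.
  rewrite -mulrA mulrCA (mulrCA 9) h -[k.+1%:R]natr1.
  have k0 : 0 <= k%:R :> R by [].
  by field; rewrite f0/=; apply: lt0r_neq0; lra.
have cvc : cvgn (series c).
  by rewrite -E; exact: exp_decaying_cvg (exp_decaying_diffs (radial_coef_decaying 1)).
have := series_tail_le (N := 4) cvc.
rewrite /radial_series' E [series c 4]/series/= !big_nat_recr//= big_geq//.
have -> : 0 + c 0%N + c 1%N + c 2%N + c 3%N = - (1 / 4) + 9 / 32 - 81 / 768 + 81 / 4096.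
  by rewrite /c !factS fact0 /=; field.
have ratio k : (3 < k)%N -> `|c k.+1| <= `|c k| / 2.
  move=> k4; have -> : c k.+1 = c k * (- (9 / 4) / (k.+2%:R * k.+1%:R)).
    rewrite /c factS natrM exprSr; field.
    by rewrite !nat1r -(natrD _ 2) !pnatr_eq0/= -lt0n fact_gt0.
  rewrite normrM ler_wpM2l// normf_div normrN ger0_norm// ger0_norm//.
  rewrite ler_pdivrMr ?mulr_gt0//.
  have : 4 ^+ 2 <= k.+2%:R * k.+1%:R :> R.
    by rewrite expr2 ler_pM// ler_nat ?leqW.
  lra.
move=> /(_ ratio) h; apply: (le_trans h).
have -> : c 4%N = - (9 ^+ 4 / 4 ^+ 4 / (20 * 24 ^+ 2)).
  by rewrite /c !factS fact0 /=; field.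
have v0 : 0 <= 9 ^+ 4 / 4 ^+ 4 / (20 * 24 ^+ 2) :> R by clear; lra.
rewrite normrN (ger0_norm v0).
by clear; lra.
Qed.

(** Up to r = 3 the power series of J_0 is computed precisely enough.  At r = 3
    the energy u^2 + u'^2 is below (27/100)^2 + (36/100)^2 < (46/100)^2, and it
    does not grow afterwards. *)
Lemma radial1_ge (r : R) : 0 <= r -> - (46 / 100) <= radial 1 r.
Proof.
move=> r0; have [r3|r3] := leP r 3.
  have x0 : 0 <= r ^+ 2 / 4 <= 9 / 4.
    rewrite divr_ge0 ?sqr_ge0//= ler_pM2r ?invr_gt0//.
    rewrite (_ : 9 = 3 ^+ 2); last by ring.
    by rewrite lerXn2r ?nnegrE.
  have := radial1_series_approx x0.
  rewrite [4 * (r ^+ 2 / 4)](_ : _ = r ^+ 2); last by field.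
  rewrite -/(radial 1 r) ler_norml => /andP[+ _].
  move: x0 (radial 1 r); set x : R := r ^+ 2 / 4 => /andP[x0 x9] u.
  have x40 : 0 <= x ^+ 4 by rewrite exprn_ge0.
  (* The cubic partial sum minus its value at 9/4, a root being factored out. *)
  have : 0 <= (9 / 4 - x) * ((x - 3) ^+ 2 / 36 + (21 / 64 - x / 48)).
    rewrite mulr_ge0//; first by clear -x9; lra.
    rewrite addr_ge0 ?divr_ge0 ?sqr_ge0 ?ler0n//; by clear -x9; lra.
  have -> : (9 / 4 - x) * ((x - 3) ^+ 2 / 36 + (21 / 64 - x / 48)) =
    1 - x + x ^+ 2 / 4 - x ^+ 3 / 36 - (1 - 9 / 4 + 81 / 64 - 81 / 256) by field.
  lra.
have := radial_energy_nincr 1 (ler0n R 3) (ltW r3).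
have := @radial1_series_approx (9 / 4).
rewrite [4 * (9 / 4)](_ : _ = 9); last by field.
have := radial1_series'_approx.
have -> : radial 1 3 = radial_series 1 (9 : R) by rewrite /radial; congr radial_series; ring.
have -> : radial' 1 3 = radial_series' 1 (9 : R) by rewrite /radial'; congr radial_series'; ring.
move: (radial_series' _ _) (radial_series _ _) => w u.
rewrite !ler_norml => /andP[w1 w2] /(_ _)/andP[|u1 u2].
  by apply/andP; split; clear; lra.
move: (radial 1 r) => v; have sqv := sqr_ge0 (2 * r * radial' 1 r) => le_E.
have w3 : - (6 / 100) <= w <= 0 by apply/andP; split; move: w1 w2; clear; lra.
have u3 : - (27 / 100) <= u <= 0 by apply/andP; split; move: u1 u2; clear; lra.
have wsq : w ^+ 2 <= (6 / 100) ^+ 2.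
  by rewrite -[leLHS]sqrrN lerXn2r ?nnegrE//; move: w3; clear; lra.
have usq : u ^+ 2 <= (27 / 100) ^+ 2.
  by rewrite -[leLHS]sqrrN lerXn2r ?nnegrE//; move: u3; clear; lra.
have : v ^+ 2 <= (46 / 100) ^+ 2.
  by move: le_E sqv wsq usq; clear; move: (_ * radial' _ _) => p; lra.
move: v {le_E} => v vsq; clear -vsq; nra.
Qed.

End energies.

(** * Integration against a probability density *)

Record pdf (R : realType) := Pdf {
  pdf_fun :> measurableTypeR R -> R;
  measurable_pdf : measurable_fun [set: _] pdf_fun;
  pdf_ge0 : forall x, 0 <= pdf_fun x;
  integral_pdf : (\int[lebesgue_measure]_x (pdf_fun x)%:E = 1)%E }.

Section density.
Local Open Scope charge_scope.
Context {R : realType}.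
Variable f : pdf R.
Local Notation leb := (@lebesgue_measure R).

(* A probability with a density: the finite trigonometric moments of the polar
   angle are then ordinary integrals over the segment from 0 to pi. *)
Definition density_prob (A : set (measurableTypeR R)) : \bar R :=
  (\int[leb]_(x in A) (f x)%:E)%E.

Let mf : measurable_fun [set: _] (EFin \o f).
Proof. by apply/measurable_EFinP; exact: (measurable_pdf f). Qed.

Let intf : leb.-integrable [set: _] (EFin \o f).
Proof.
apply/integrableP; split => //.
under eq_integral do rewrite /= ger0_norm ?pdf_ge0//.
rewrite (_ : (\int[_]_(_ in _) _)%E = 1%E); [exact: ltry|exact: integral_pdf].
Qed.

Let density0 : density_prob set0 = 0%E.
Proof. by rewrite /density_prob integral_set0. Qed.

Let density_ge0 A : (0 <= density_prob A)%E.
Proof. by apply: integral_ge0 => x _; rewrite lee_fin pdf_ge0. Qed.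

Let density_sigma_additive : semi_sigma_additive density_prob.
Proof.
move=> /= A mA tA mUA; rewrite /density_prob/= integral_bigcup//=.
  apply: is_cvg_ereal_nneg_natsum_cond => n _ _.
  by apply: integral_ge0 => x _; rewrite lee_fin pdf_ge0.
exact: (integrableS _ _ (subsetT _)).
Qed.

HB.instance Definition _ := isMeasure.Build _ _ _ density_prob
  density0 density_ge0 density_sigma_additive.

Let density_setT : density_prob [set: _] = 1%E.
Proof. exact: integral_pdf. Qed.

HB.instance Definition _ :=
  @Measure_isProbability.Build _ _ R density_prob density_setT.

Let density_dominates : density_prob `<< leb.
Proof.
apply/null_content_dominatesP => A mA A0.
by apply: null_set_integral => //; exact: measurable_funTS.
Qed.

(** By uniqueness the Radon-Nikodym derivative of the measure is its density,
    so the change of variables for that derivative applies. *)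
Lemma Rintegral_density (g : measurableTypeR R -> R) (K : R) :
  measurable_fun [set: _] g -> (forall x, `|g x| <= K) ->
  \int[density_prob]_x g x = \int[leb]_x (g x * f x).
Proof.
move=> mg gK; congr fine.
have intg : density_prob.-integrable setT (EFin \o g).
  exact: bounded_integrable gK.
rewrite -(Radon_Nikodym_change_of_variables density_dominates)//.
have dint : leb.-integrable setT
    ('d (charge_of_finite_measure density_prob) '/d leb).
  exact: Radon_Nikodym_integrable.
apply: ae_eq_integral => //.
- by apply: emeasurable_funM; [exact/measurable_EFinP|exact: measurable_int dint].
- apply/measurable_EFinP; apply: measurable_funM => //; exact: measurable_pdf.
have : ae_eq leb setT ('d (charge_of_finite_measure density_prob) '/d leb)
    (EFin \o f).
  apply: integral_ae_eq => // A _ mA.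
  by rewrite -Radon_Nikodym_integral.
by apply: filterS => x /(_ I) /= dE _; rewrite dE ?EFinM.
Qed.

End density.

(** * Moments of the polar angle *)

Section trig_integrals.
Context {R : realType}.
Local Notation leb := (@lebesgue_measure R).

Definition trig_integral (i j : nat) : R :=
  \int[leb]_(x in `[0, pi]) (cos x ^+ i * sin x ^+ j).

Lemma continuous_trig i j : continuous (fun x : R => cos x ^+ i * sin x ^+ j).
Proof.
move=> x; apply: cvgM.
  exact: (continuous_comp (@continuous_cos R x) (@exprn_continuous R i _)).
exact: (continuous_comp (@continuous_sin R x) (@exprn_continuous R j _)).
Qed.

Lemma continuous_integrable0pi (f : R -> R) : continuous f ->
  leb.-integrable `[0, pi] (EFin \o f).
Proof.
move=> cf; apply: continuous_compact_integrable; first exact: segment_compact.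
exact: continuous_subspaceT.
Qed.

Lemma Rintegral_FTC (F f : R -> R) (a b : R) : a < b ->
  (forall x, is_derive x (1 : R) F (f x)) -> continuous f ->
  \int[leb]_(x in `[a, b]) f x = F b - F a.
Proof.
move=> ab dF cf; rewrite /Rintegral (@continuous_FTC2 _ f F a b)//.
- exact: continuous_subspaceT.
- have cF : continuous F.
    move=> x; apply: differentiable_continuous; apply/derivable1_diffP.
    exact: ex_derive.
  split => [x _||]; first exact: ex_derive.
    exact: cvg_at_right_filter (cF a).
  exact: cvg_at_left_filter (cF b).
- by move=> x _; rewrite derive1E derive_val.
Qed.

Lemma is_derive_trig i j (x : R) :
  is_derive x (1 : R) (fun x => cos x ^+ i.+1 * sin x ^+ j.+1)
    (j.+1%:R * (cos x ^+ i.+2 * sin x ^+ j)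
     - i.+1%:R * (cos x ^+ i * sin x ^+ j.+2)).
Proof.
rewrite (_ : (fun x => _) = cos ^+ i.+1 * sin ^+ j.+1); last first.
  by apply/funext => y; rewrite fctE !exprfctE.
apply: is_derive_eq; rewrite /GRing.scale/= !exprfctE !exprS; ring.
Qed.

Let continuous_cmul (a : R) (f : R -> R) :
  continuous f -> continuous (fun x => a * f x).
Proof. by move=> cf x; apply: cvgM; [exact: cvg_cst|exact: cf]. Qed.

(** Integration by parts: cos^(i+1) sin^(j+1) vanishes at 0 and at pi. *)
Lemma trig_integral_rec i j :
  j.+1%:R * trig_integral i.+2 j = i.+1%:R * trig_integral i j.+2.
Proof.
have ct k l := @continuous_trig k l; have ci := continuous_integrable0pi.
have cc a k l := continuous_cmul (a := a) (ct k l).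
apply/eqP; rewrite -subr_eq0; apply/eqP.
rewrite /trig_integral -!RintegralZl//; [|exact: ci..].
rewrite -RintegralB//; [|exact: ci..].
rewrite (Rintegral_FTC (pi_gt0 R) (is_derive_trig i j)).
  by rewrite sinpi sin0 !expr0n/= !mulr0 subrr.
by move=> x; apply: cvgB; exact: cc.
Qed.

Lemma trig_integral_split i j :
  trig_integral i j = trig_integral i.+2 j + trig_integral i j.+2.
Proof.
have ct k l := @continuous_trig k l; have ci := continuous_integrable0pi.
rewrite /trig_integral -RintegralD//; [|exact: ci..].
apply: eq_Rintegral => x _; rewrite !exprS.
have := cos2Dsin2 x; move: (cos x) (sin x) => a b ab.
by rewrite -[LHS]mulr1 -ab; ring.
Qed.

Lemma trig_integral_cosSS i j :
  (i + j).+2%:R * trig_integral i.+2 j = i.+1%:R * trig_integral i j.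
Proof.
rewrite (trig_integral_split i j) mulrDr -trig_integral_rec -mulrDl -natrD.
by congr (_%:R * _); rewrite addSn addnS.
Qed.

Lemma trig_integral_sinSS i j :
  (i + j).+2%:R * trig_integral i j.+2 = j.+1%:R * trig_integral i j.
Proof.
rewrite (trig_integral_split i j) mulrDr trig_integral_rec -mulrDl -natrD.
by congr (_%:R * _); rewrite addSn addnS.
Qed.

(** For exponent 1 the integrand is an exact derivative; the reduction formula
    for the cosine does the rest. *)
Lemma trig_integral_cos_odd i j : trig_integral i.*2.+1 j = 0.
Proof.
elim: i => [|i IH]; last first.
  apply/eqP; have /eqP := trig_integral_cosSS i.*2.+1 j.
  by rewrite doubleS IH mulr0 mulf_eq0 pnatr_eq0.
have d x : is_derive x (1 : R) (fun x : R => sin x ^+ j.+1)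
    (j.+1%:R * (cos x ^+ 1 * sin x ^+ j)).
  rewrite (_ : (fun x => _) = sin ^+ j.+1); last by rewrite exprfctE.
  by apply: is_derive_eq; rewrite /GRing.scale/=; ring.
have ct k l := @continuous_trig k l; have ci := continuous_integrable0pi.
have := Rintegral_FTC (pi_gt0 R) d (continuous_cmul (ct 1 j)).
rewrite RintegralZl//; last exact: ci.
rewrite sinpi sin0 subrr => /eqP; rewrite mulf_eq0 pnatr_eq0/=.
by move=> /eqP.
Qed.

Lemma trig_integral_sin_gt0 j : 0 < trig_integral 0 j.
Proof.
suff : 0 < trig_integral 0 j /\ 0 < trig_integral 0 j.+1 by case.
elim: j => [|j [IH0 IH1]]; last first.
  split => //; rewrite -(pmulr_rgt0 _ (ltr0n R (0 + j).+2)) trig_integral_sinSS.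
  by rewrite mulr_gt0.
split.
  have d x : is_derive x (1 : R) id ((cos x ^+ 0 * sin x ^+ 0)).
    by rewrite !expr0 mulr1; exact: is_derive_id.
  by rewrite /trig_integral (Rintegral_FTC (pi_gt0 R) d) ?subr0 ?pi_gt0//;
    exact: continuous_trig.
have d x : is_derive x (1 : R) (fun x : R => - cos x) ((cos x ^+ 0 * sin x ^+ 1)).
  by apply: is_derive_eq; rewrite expr0 mul1r expr1 opprK.
rewrite /trig_integral (Rintegral_FTC (pi_gt0 R) d).
  by rewrite cospi cos0 !opprK addr_gt0.
exact: continuous_trig.
Qed.

Definition sin_density n (x : measurableTypeR R) : R :=
  (\1_(`[0, pi] : set R) x) * (sin x ^+ n / trig_integral 0 n).

Lemma measurable_trig i j : measurable_fun [set: measurableTypeR R]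
  (fun x : R => cos x ^+ i * sin x ^+ j).
Proof. by apply: continuous_measurable_fun; exact: continuous_trig. Qed.

Lemma measurable_sin_density n : measurable_fun [set: _] (sin_density n).
Proof.
apply: measurable_funM; first exact: measurable_indic.
apply: measurable_funM => //.
have := measurable_trig 0 n.
by apply: eq_measurable_fun => x _; rewrite expr0 mul1r.
Qed.

Lemma sin_density_ge0 n x : 0 <= sin_density n x.
Proof.
rewrite /sin_density indicE; case: (boolP (_ \in _)); last by rewrite mul0r.
rewrite inE/= => x0pi; rewrite mul1r divr_ge0 ?(ltW (trig_integral_sin_gt0 _))//.
by rewrite exprn_ge0// sin_ge0_pi.
Qed.

Lemma integral_sin_density_trig n i j :
  \int[leb]_x (cos x ^+ i * sin x ^+ j * sin_density n x) =
  trig_integral i (j + n) / trig_integral 0 n.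
Proof.
rewrite /trig_integral -RintegralZr//; last first.
  exact/continuous_integrable0pi/continuous_trig.
rewrite [RHS]Rintegral_mkcond; apply: eq_Rintegral => x _.
rewrite patchE /sin_density indicE; case: (boolP (_ \in _)) => _.
  by rewrite mul1r exprD !mulrA.
by rewrite mul0r mulr0.
Qed.

Lemma integral_sin_density n : (\int[leb]_x (sin_density n x)%:E = 1)%E.
Proof.
have := integral_sin_density_trig n 0 0.
rewrite add0n divff ?gt_eqF ?trig_integral_sin_gt0//.
rewrite /Rintegral.
under eq_integral do rewrite !expr0 !mul1r.
case: (\int[leb]_x (sin_density n x)%:E)%E => [r /= ->//||] /= /esym/eqP;
  by rewrite oner_eq0.
Qed.

Definition sin_pdf n := Pdf (@measurable_sin_density n)
  (sin_density_ge0 n) (integral_sin_density n).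

(** The law of the angle between a uniform point of the sphere of R^(n+2) and a
    fixed axis: the slice at angle x is a sphere of radius sin x in R^(n+1), of
    surface proportional to sin^n x. *)
Definition polar_prob n : probability (measurableTypeR R) R :=
  density_prob (sin_pdf n).

Definition trig_moment n i j : R :=
  \int[polar_prob n]_x (cos x ^+ i * sin x ^+ j).

Lemma trig_le1 i j (x : R) : `|cos x ^+ i * sin x ^+ j| <= 1.
Proof.
by rewrite normrM !normrX mulr_ile1 ?exprn_ge0// exprn_ile1// ?cos_max ?sin_max.
Qed.

Lemma trig_momentE n i j :
  trig_moment n i j = trig_integral i (j + n) / trig_integral 0 n.
Proof.
rewrite /trig_moment /polar_prob.
rewrite (Rintegral_density (sin_pdf n) (measurable_trig i j) (trig_le1 i j)).
exact: integral_sin_density_trig.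
Qed.

Lemma trig_moment00 n : trig_moment n 0 0 = 1.
Proof. by rewrite trig_momentE divff// gt_eqF// trig_integral_sin_gt0. Qed.

Let divS (m : nat) (a x y : R) : m.+1%:R * x = a * y -> x = a / m.+1%:R * y.
Proof. by move=> h; rewrite mulrAC -h mulrC mulKf// pnatr_eq0. Qed.

Lemma trig_moment_cosSS n i j :
  trig_moment n i.+2 j = i.+1%:R / (i + j + n).+2%:R * trig_moment n i j.
Proof.
rewrite !trig_momentE mulrA; congr (_ / _); apply: divS.
by rewrite -addnA trig_integral_cosSS.
Qed.

Lemma trig_moment_sinSS n i j :
  trig_moment n i j.+2 = (j + n).+1%:R / (i + j + n).+2%:R * trig_moment n i j.
Proof.
rewrite !trig_momentE mulrA; congr (_ / _); apply: divS.
by rewrite -addnA trig_integral_sinSS.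
Qed.

Lemma trig_moment_cos_odd n i j : trig_moment n i.*2.+1 j = 0.
Proof. by rewrite trig_momentE trig_integral_cos_odd mul0r. Qed.

(** The binomial convolution expressing that averaging over the polar angle
    takes the series of radial n to that of radial n.+1. *)
Lemma trig_moment_radial_coef n i j :
  (-1) ^+ i * trig_moment n i.*2 j.*2 / i.*2`!%:R * radial_coef n j =
  'C(i + j, j)%:R * radial_coef n.+1 (i + j).
Proof.
elim: i => [|i IH].
  rewrite add0n binn double0 expr0 fact0 divr1 !mul1r.
  elim: j => [|j IH]; first by rewrite trig_moment00 mul1r.
  rewrite doubleS trig_moment_sinSS [in RHS]/= -IH [in LHS]/= add0n.
  have e1 : (j.*2 + n).+1%:R = 2 * j%:R + n%:R + 1 :> R.
    by rewrite -natr1 natrD -muln2 natrM; ring.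
  have e2 : (j.*2 + n).+2%:R = 2 * j%:R + n%:R + 2 :> R.
    by rewrite -natr1 e1; ring.
  have e3 : 2 * j%:R + n.+1%:R + 1 = 2 * j%:R + n%:R + 2 :> R.
    by rewrite -natr1; ring.
  rewrite e1 e2 e3.
  have j0 : 0 <= j%:R :> R by [].
  have n0 : 0 <= n%:R :> R by [].
  field; apply/and3P; split; apply: lt0r_neq0; lra.
have binS : 'C(i.+1 + j, j)%:R = (i + j).+1%:R / i.+1%:R * 'C(i + j, j)%:R :> R.
  apply: divS; rewrite -!natrM; congr _%:R.
  by have := mul_bin_down (i.+1 + j) j; rewrite addnK.
have -> : radial_coef n.+1 (i.+1 + j) = - radial_coef n.+1 (i + j) /
    ((2 * (i + j)%:R + 2) * (2 * (i + j)%:R + n.+1%:R + 1)) :> R by [].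
rewrite doubleS trig_moment_cosSS binS !factS !natrM exprS.
have -> : (i.*2 + j.*2 + n).+2%:R = 2 * (i%:R + j%:R) + n%:R + 2 :> R.
  by rewrite -!natr1 !natrD -!muln2 !natrM; ring.
rewrite natrD -[n.+1%:R]natr1 -[(i + j).+1%:R]natr1 natrD.
have f0 : i.*2`!%:R != 0 :> R by rewrite pnatr_eq0 -lt0n fact_gt0.
have i1 : i.*2.+1%:R = 2 * i%:R + 1 :> R by rewrite -natr1 -muln2 natrM; ring.
have i2 : i.*2.+2%:R = 2 * i%:R + 2 :> R by rewrite -natr1 i1; ring.
rewrite -[i.+1%:R]natr1 i1 i2.
have i0 : 0 <= i%:R :> R by [].
have j0 : 0 <= j%:R :> R by [].
have n0 : 0 <= n%:R :> R by [].
transitivity ((2 * i%:R + 1) / (2 * (i%:R + j%:R) + n%:R + 2) /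
    ((2 * i%:R + 2) * (2 * i%:R + 1)) *
    - ((-1) ^+ i * trig_moment n i.*2 j.*2 / i.*2`!%:R * radial_coef n j)).
  by field; do ?[apply/andP; split] => //; apply: lt0r_neq0; lra.
rewrite IH; field; do ?[apply/andP; split] => //; apply: lt0r_neq0; lra.
Qed.

End trig_integrals.

Section probability_integrals.
Context {R : realType}.

Lemma Rintegral_bounded_sum d1 (T : measurableType d1) (P : probability T R)
    (N : nat) (f : nat -> T -> R) (K : nat -> R) :
  (forall i, measurable_fun [set: T] (f i)) ->
  (forall i x, `|f i x| <= K i) ->
  \int[P]_x (\sum_(i < N) f i x) = \sum_(i < N) \int[P]_x f i x.
Proof.
move=> mf fK; elim: N => [|N IH].
  under eq_Rintegral do rewrite big_ord0.
  by rewrite big_ord0 Rintegral_cst// mul0r.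
under eq_Rintegral do rewrite big_ord_recr/=.
rewrite big_ord_recr/= -IH RintegralD//.
  apply: (@bounded_integrable _ _ _ P _ (\sum_(i < N) K i)).
    exact: measurable_sum.
  by move=> x; rewrite (le_trans (ler_norm_sum _ _ _))// ler_sum.
exact: bounded_integrable (fK N).
Qed.

Lemma Rintegral_prodM d1 d2 (T1 : measurableType d1) (T2 : measurableType d2)
    (P1 : probability T1 R) (P2 : probability T2 R)
    (f : T1 -> R) (g : T2 -> R) (K L : R) :
  measurable_fun [set: T1] f -> measurable_fun [set: T2] g ->
  (forall x, `|f x| <= K) -> (forall x, `|g x| <= L) ->
  \int[(P1 \x P2)%E]_z (f z.1 * g z.2) = (\int[P1]_x f x) * (\int[P2]_x g x).
Proof.
move=> mf mg fK gL.
have intg : P2.-integrable setT (EFin \o g) by exact: bounded_integrable gL.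
rewrite -(@Rintegral_prod1 _ _ _ _ _ P1 P2 (fun z => f z.1 * g z.2)).
- rewrite -RintegralZr//; last exact: bounded_integrable fK.
  by apply: eq_Rintegral => x _; rewrite /= RintegralZl.
- pose Q : probability _ R := (P1 \x P2)%E.
  apply: (@bounded_integrable _ _ _ Q _ (K * L)).
    apply: measurable_funM.
      exact: (measurableT_comp mf measurable_fst).
    exact: (measurableT_comp mg measurable_snd).
  by move=> x; rewrite normrM ler_pM.
- move=> x; apply: (@bounded_integrable _ _ _ P2 _ (K * L)).
    by rewrite /=; apply: measurable_funM => //; exact: measurable_cst.
  by move=> y; rewrite normrM ler_pM.
Qed.

End probability_integrals.

Lemma sum_even_terms (R : pzRingType) (F : nat -> R) k :
  (forall j, F j.*2.+1 = 0) ->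
  \sum_(l < k.*2.+1) F l = \sum_(j < k.+1) F j.*2.
Proof.
move=> F0; elim: k => [|k IH]; first by rewrite !big_ord_recl !big_ord0.
by rewrite doubleS !(big_ord_recr k.*2.+2) (big_ord_recr k.*2.+1)/= IH F0 addr0
  [RHS]big_ord_recr.
Qed.

(** * The uniform measure on the sphere *)

Section sphere.
Context {R : realType}.

(** A random unit vector w of R^(n+1) whose linear images have the moments of
    those of a uniform one.  Only these moments enter the Fourier transform,
    and they pass to the next dimension by a finite computation. *)
Definition uniform_sphere n dT (T : measurableType dT) (P : probability T R)
    (w : T -> Rn R n.+1) : Prop :=
  [/\ measurable_fun [set: T] w, forall p, enorm (w p) = 1,
      forall xi k, (-1) ^+ k * (\int[P]_p (dotp (w p) xi ^+ k.*2)) / k.*2`!%:R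
        = radial_coef n k * (enorm xi ^+ 2) ^+ k
    & forall xi k, \int[P]_p (dotp (w p) xi ^+ k.*2.+1) = 0].

Lemma uniform_sphere_le n dT (T : measurableType dT) (P : probability T R)
    (w : T -> Rn R n.+1) xi p :
  uniform_sphere P w -> `|dotp (w p) xi| <= enorm xi.
Proof. by case=> _ w1 _ _; rewrite (le_trans (dotp_le _ _))// w1 mul1r. Qed.

Definition polar n (T : Type) (w : T -> Rn R n.+1)
    (z : measurableTypeR R * T) : Rn R n.+2 :=
  [tuple of cos z.1 :: vscale (sin z.1) (w z.2)].

Definition tuple_tail n (xi : Rn R n.+1) : Rn R n :=
  [tuple coord xi (lift ord0 i) | i < n].

Lemma coord_polar0 n (T : Type) (w : T -> Rn R n.+1) z :
  coord (polar w z) ord0 = cos z.1.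
Proof. exact: tnth0. Qed.

Lemma coord_polarS n (T : Type) (w : T -> Rn R n.+1) z i :
  coord (polar w z) (lift ord0 i) = sin z.1 * coord (w z.2) i.
Proof.
rewrite /coord tnthS -[RHS](@coord_mktuple _ _ (fun i => sin z.1 * coord (w z.2) i)).
by congr tnth; apply: val_inj.
Qed.

Lemma sum_coord_polar n (T : Type) (w : T -> Rn R n.+1) z (F : 'I_n.+2 -> R -> R) :
  \sum_i F i (coord (polar w z) i) =
  F ord0 (cos z.1) + \sum_i F (lift ord0 i) (sin z.1 * coord (w z.2) i).
Proof.
rewrite big_ord_recl coord_polar0; congr (_ + _).
by apply: eq_bigr => i _; rewrite coord_polarS.
Qed.

Lemma dotp_polar n (T : Type) (w : T -> Rn R n.+1) z xi :
  dotp (polar w z) xi =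
  cos z.1 * coord xi ord0 + sin z.1 * dotp (w z.2) (tuple_tail xi).
Proof.
rewrite /dotp (sum_coord_polar w z (fun i c => c * coord xi i)); congr (_ + _).
by rewrite mulr_sumr; apply: eq_bigr => i _; rewrite coord_mktuple mulrA.
Qed.

Lemma enorm_polar n (T : Type) (w : T -> Rn R n.+1) z :
  enorm (w z.2) = 1 -> enorm (polar w z) = 1.
Proof.
move=> w1; rewrite /enorm (sum_coord_polar w z (fun _ c => c ^+ 2)).
under eq_bigr do rewrite exprMn.
by rewrite -mulr_sumr -sqr_enorm w1 expr1n mulr1 cos2Dsin2 sqrtr1.
Qed.

Lemma sqr_enorm_head_tail n (xi : Rn R n.+1) :
  enorm xi ^+ 2 = coord xi ord0 ^+ 2 + enorm (tuple_tail xi) ^+ 2.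
Proof.
rewrite !sqr_enorm big_ord_recl; congr (_ + _).
by apply: eq_bigr => i _; rewrite coord_mktuple.
Qed.

End sphere.

Section sphere_step.
Context {R : realType} {n : nat} {dT} {T : measurableType dT}.
Variables (P : probability T R) (w : T -> Rn R n.+1).
Hypothesis Pw : uniform_sphere P w.

Let Q : probability _ R := (polar_prob n \x P)%E.

Lemma measurable_polar : measurable_fun [set: _] (polar w).
Proof.
have [mw _ _ _] := Pw.
apply/measurable_fun_tnthP => i.
case: (unliftP ord0 i) => [j ->|->].
  apply: (@eq_measurable_fun _ _ _ _ _ (fun z => sin z.1 * coord (w z.2) j)).
    by move=> z _; exact/esym/coord_polarS.
  apply: measurable_funM.
    apply: (measurableT_comp _ measurable_fst).
    by apply: continuous_measurable_fun; exact: continuous_sin.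
  apply: (measurableT_comp (measurable_coord j)).
  exact: (measurableT_comp mw measurable_snd).
apply: (@eq_measurable_fun _ _ _ _ _ (fun z => cos z.1)).
  by move=> z _; rewrite /= tnth0.
apply: (measurableT_comp _ measurable_fst).
by apply: continuous_measurable_fun; exact: continuous_cos.
Qed.

(** Binomial expansion of (cos * xi_0 + sin * (w, xi'))^K; the angle and the
    lower-dimensional vector are independent. *)
Lemma polar_moment xi K :
  \int[Q]_z (dotp (polar w z) xi ^+ K) =
  \sum_(l < K.+1) 'C(K, l)%:R * coord xi ord0 ^+ (K - l) *
    trig_moment n (K - l) l * \int[P]_p (dotp (w p) (tuple_tail xi) ^+ l).
Proof.
have [mw _ _ _] := Pw.
under eq_Rintegral do rewrite dotp_polar exprDn.
pose f l (z : measurableTypeR R * T) : R :=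
  ('C(K, l)%:R * coord xi ord0 ^+ (K - l) * (cos z.1 ^+ (K - l) * sin z.1 ^+ l)) *
  dotp (w z.2) (tuple_tail xi) ^+ l.
transitivity (\int[Q]_z (\sum_(l < K.+1) f l z)).
  apply: eq_Rintegral => z _; apply: eq_bigr => l _.
  by rewrite /f -mulr_natl !exprMn; ring.
have md : measurable_fun [set: T] (fun p => dotp (w p) (tuple_tail xi)).
  exact: measurable_dotp_fun.
pose C l := 'C(K, l)%:R * coord xi ord0 ^+ (K - l).
have mC l : measurable_fun [set: measurableTypeR R]
    (fun x : R => C l * (cos x ^+ (K - l) * sin x ^+ l)).
  by apply: measurable_funM => //; exact: measurable_trig.
have CK l x : `|C l * (cos x ^+ (K - l) * sin x ^+ l)| <= `|C l|.
  by rewrite normrM ler_piMr// trig_le1.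
have dK l p : `|dotp (w p) (tuple_tail xi) ^+ l| <= enorm (tuple_tail xi) ^+ l.
  by rewrite normrX lerXn2r ?nnegrE ?enorm_ge0//; exact: uniform_sphere_le Pw.
rewrite (@Rintegral_bounded_sum _ _ _ Q K.+1 f
  (fun l => `|C l| * enorm (tuple_tail xi) ^+ l)).
- apply: eq_bigr => l _.
  rewrite (Rintegral_prodM (polar_prob n) P (mC l) (measurable_funX l md)
    (CK l) (dK l)).
  rewrite RintegralZl//.
  apply: (@bounded_integrable _ _ _ (polar_prob n) _ 1).
    exact: measurable_trig.
  exact: trig_le1.
- move=> l; apply: measurable_funM.
    exact: (measurableT_comp (mC l) measurable_fst).
  exact: (measurableT_comp (measurable_funX l md) measurable_snd).
- by move=> l z; rewrite normrM ler_pM ?CK ?dK.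
Qed.

Lemma uniform_sphere_polar : uniform_sphere Q (polar w).
Proof.
have [mw w1 even_w odd_w] := Pw; split.
- exact: measurable_polar.
- by move=> z; exact: enorm_polar.
- move=> xi k; rewrite polar_moment.
  rewrite (@sum_even_terms _ (fun l => 'C(k.*2, l)%:R *
    coord xi ord0 ^+ (k.*2 - l) * trig_moment n (k.*2 - l) l *
    \int[P]_p (dotp (w p) (tuple_tail xi) ^+ l))); last first.
    by move=> j; rewrite odd_w mulr0.
  rewrite sqr_enorm_head_tail exprDn mulr_sumr mulr_suml mulr_sumr.
  apply: eq_bigr => -[j /=]; rewrite ltnS => jk _.
  have [i ki] : exists i, k = (i + j)%N by exists (k - j)%N; rewrite subnK.
  have bin : 'C(k.*2, j.*2)%:R / k.*2`!%:R =
      (i.*2`!%:R)^-1 * (j.*2`!%:R)^-1 :> R.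
    have f0 l : l`!%:R != 0 :> R by rewrite pnatr_eq0 -lt0n fact_gt0.
    rewrite -(@bin_fact k.*2 j.*2) ?leq_double// !natrM -doubleB ki addnK.
    have b0 : 'C((i + j).*2, j.*2)%:R != 0 :> R.
      by rewrite pnatr_eq0 -lt0n bin_gt0 leq_double leq_addl.
    by field; rewrite b0 !f0.
  have kij : (k - j = i)%N by rewrite ki addnK.
  have := trig_moment_radial_coef n i j; rewrite -ki -doubleB kij => tr.
  set I := Rintegral _ _ _; set x := coord xi ord0.
  transitivity (((-1) ^+ i * trig_moment n i.*2 j.*2 / i.*2`!%:R) *
     ((-1) ^+ j * I / j.*2`!%:R) * x ^+ i.*2).
    rewrite [in (-1) ^+ k]ki exprD.
    transitivity ((-1) ^+ i * (-1) ^+ j * x ^+ i.*2 * trig_moment n i.*2 j.*2 *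
      I * ('C(k.*2, j.*2)%:R / k.*2`!%:R)); first by ring.
    by rewrite bin; ring.
  rewrite even_w [RHS]mulrnAr -[RHS]mulr_natl [RHS]mulrA -tr -!exprM !mul2n.
  ring.
- move=> xi k; rewrite polar_moment big1// => -[l /=]; rewrite ltnS => lk _.
  have [lodd|leven] := boolP (odd l).
    by rewrite -[in X in _ * X](odd_double_half l) lodd odd_w mulr0.
  rewrite (_ : (k.*2.+1 - l = (k - l./2).*2.+1)%N).
    by rewrite trig_moment_cos_odd mulr0 mul0r.
  have l2 : (l./2 <= k)%N by have := half_leq lk; rewrite /= uphalf_double.
  rewrite -[in LHS](odd_double_half l) (negbTE leven) add0n subSn ?leq_double//.
  by rewrite doubleB.
Qed.

End sphere_step.

(* The integral against a Bernoulli law is known for nonnegative functions;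
   adding a constant reduces the general case to it. *)
Lemma integral_bernoulli_half (R : realType) (f : bool -> R) :
  \int[bernoulli_prob (2^-1 : R)]_b f b = (f true + f false) / 2.
Proof.
pose K := `|f true| + `|f false|.
have fK b : 0 <= f b + K.
  rewrite -(opprK (f b)) addrC subr_ge0 (le_trans (ler_norm _))// normrN.
  by case: b; rewrite /K ?lerDl ?lerDr.
have bint (g : bool -> R) : (bernoulli_prob (2^-1 : R)).-integrable setT (EFin \o g).
  apply: (@bounded_integrable _ _ _ (bernoulli_prob (2^-1 : R)) _ (`|g true| + `|g false|)) => //.
  by case; rewrite ?lerDl ?lerDr.
have : \int[bernoulli_prob (2^-1 : R)]_b (f b + K) = (f true + f false) / 2 + K.
  have p01 : 0 <= (2^-1 : R) <= 1 by rewrite invr_ge0 ler0n invf_le1 ?ler1n ?ltr0n.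
  rewrite /Rintegral (@integral_bernoulli_prob R 2^-1 p01) => [|b].
    by rewrite /= /unstable.onem; field.
  by rewrite lee_fin.
rewrite RintegralD//; try exact: bint.
rewrite Rintegral_cst// [X in _ * X](_ : _ = 1); last first.
  by rewrite -[RHS]/(fine 1%E); congr fine; exact: probability_setT.
rewrite mulr1.
exact: addIr.
Qed.

Section sphere_exists.
Context {R : realType}.

Definition signs (b : bool) : Rn R 1 := [tuple (-1) ^+ b | _ < 1].

Lemma radial_coef0E k : radial_coef 0 k = (-1) ^+ k / k.*2`!%:R :> R.
Proof.
elim: k => [|k IH]; first by rewrite expr0 fact0 divr1.
rewrite /= IH doubleS !factS !natrM exprS.
have e1 : k.*2.+1%:R = 2 * k%:R + 1 :> R by rewrite -natr1 -muln2 natrM; ring.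
have e2 : k.*2.+2%:R = 2 * k%:R + 2 :> R by rewrite -natr1 e1; ring.
rewrite e1 e2.
have f0 : k.*2`!%:R != 0 :> R by rewrite pnatr_eq0 -lt0n fact_gt0.
have k0 : 0 <= k%:R :> R by [].
by field; do ?[apply/andP; split] => //; apply: lt0r_neq0; lra.
Qed.

Lemma uniform_sphere_signs : uniform_sphere (bernoulli_prob (2^-1 : R)) signs.
Proof.
have dE b xi : dotp (signs b) xi = (-1) ^+ b * coord xi ord0.
  by rewrite /dotp big_ord1 coord_mktuple.
split.
- by [].
- move=> b; rewrite /enorm big_ord1 coord_mktuple -exprM mulnC exprM sqrrN expr1n.
  by rewrite expr1n sqrtr1.
- move=> xi k; rewrite integral_bernoulli_half !dE expr1 expr0 mul1r.
  rewrite radial_coef0E sqr_enorm big_ord1 -!mul2n !exprM mulN1r sqrrN.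
  have f0 : (2 * k)`!%:R != 0 :> R by rewrite pnatr_eq0 -lt0n fact_gt0.
  by field.
- move=> xi k; rewrite integral_bernoulli_half !dE expr1 expr0 mul1r.
  by rewrite mulN1r !exprS -!mul2n !exprM sqrrN mulNr addNr mul0r.
Qed.

Lemma uniform_sphere_exists n : exists dT (T : measurableType dT)
  (P : probability T R) (w : T -> Rn R n.+1), uniform_sphere P w.
Proof.
elim: n => [|n [dT [T [P [w Pw]]]]].
  by do 4 eexists; exact: uniform_sphere_signs.
by do 4 eexists; exact: uniform_sphere_polar Pw.
Qed.

End sphere_exists.

Section sphere_transform.
Context {R : realType} {n : nat} {dT} {T : measurableType dT}.
Variables (P : probability T R) (w : T -> Rn R n.+1).
Hypothesis Pw : uniform_sphere P w.

(** Expand the cosine and integrate termwise, the exponential series of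
    |xi|^2 being an integrable majorant of the partial sums. *)
Lemma uniform_sphere_cos xi :
  \int[P]_p cos (dotp (w p) xi) = radial n (enorm xi).
Proof.
have [mw _ even_w _] := Pw.
pose f N (p : T) := series (cos_coeff' (dotp (w p) xi)) N.
pose K := limn (series (exp_coeff (enorm xi ^+ 2))).
have md : measurable_fun [set: T] (fun p => dotp (w p) xi).
  exact: measurable_dotp_fun.
have termK k p : `|cos_coeff' (dotp (w p) xi) k| <= exp_coeff (enorm xi ^+ 2) k.
  rewrite /cos_coeff' /exp_coeff/= !normrM normrX normrN1 expr1n mul1r.
  rewrite normfV normr_nat -mul2n exprM normrX normrX.
  apply: ler_pM; rewrite ?exprn_ge0 ?invr_ge0//.
    rewrite lerXn2r ?nnegrE ?exprn_ge0 ?enorm_ge0//.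
    by rewrite lerXn2r ?nnegrE ?enorm_ge0// (uniform_sphere_le _ _ Pw).
  rewrite lef_pV2 ?posrE ?ltr0n ?fact_gt0// ler_nat.
  by rewrite leq_fact// leq_pmull.
have mterm k : measurable_fun [set: T] (fun p => cos_coeff' (dotp (w p) xi) k).
  rewrite /cos_coeff'; apply: measurable_funM => //.
  by apply: measurable_funM => //; exact: measurable_funX.
have fK N p : `|f N p| <= K.
  apply: (le_trans (ler_norm_sum _ _ _)).
  apply: (@le_trans _ _ (series (exp_coeff (enorm xi ^+ 2)) N)).
    by apply: ler_sum => k _.
  apply: nondecreasing_cvgn_le; last exact: is_cvg_series_exp_coeff.
  by apply: nondecreasing_series => k _ _; rewrite exp_coeff_ge0// sqr_ge0.
have mf N : measurable_fun [set: T] (f N).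
  by apply: measurable_sum => k.
have mf' N : measurable_fun [set: T] (fun p => (f N p)%:E).
  exact/measurable_EFinP.
have mcos : measurable_fun [set: T] (fun p => (cos (dotp (w p) xi))%:E).
  apply/measurable_EFinP; apply: (measurableT_comp _ md).
  by apply: continuous_measurable_fun; exact: continuous_cos.
have cvf p : [set: T] p ->
    (f N p)%:E @[N --> \oo] --> (cos (dotp (w p) xi))%:E.
  by move=> _; apply: cvg_EFin; [exact: nearW|exact: cvg_cos_coeff'].
have intK : P.-integrable [set: T] (cst K%:E).
  exact: finite_measure_integrable_cst.
have lefK p N : [set: T] p -> (`|(f N p)%:E| <= K%:E)%E.
  by move=> _; rewrite lee_fin.
have [_ _ cvI] := dominated_convergence measurableT mf' mcos (aeW P cvf) intK
  (aeW P lefK).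
have intf N : (\int[P]_p (f N p)%:E =
    (pseries (radial_coef n) (enorm xi ^+ 2) N)%:E)%E.
  rewrite -[LHS]fineK; last first.
    by apply: integrable_fin_num => //; exact: bounded_integrable (fK N).
  congr _%:E.
  transitivity (\int[P]_p (\sum_(k < N) cos_coeff' (dotp (w p) xi) k)).
    by apply: eq_Rintegral => p _; rewrite /f /series/= big_mkord.
  rewrite (@Rintegral_bounded_sum _ _ _ P N
    (fun k p => cos_coeff' (dotp (w p) xi) k) (exp_coeff (enorm xi ^+ 2)))//.
  rewrite /pseries /series/= big_mkord; apply: eq_bigr => k _.
  rewrite -even_w /cos_coeff'; under eq_Rintegral do rewrite mulrAC.
  rewrite RintegralZl//; last first.
    apply: (@bounded_integrable _ _ _ P _ (enorm xi ^+ k.*2)).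
      exact: measurable_funX.
    move=> p; rewrite normrX lerXn2r ?nnegrE ?enorm_ge0//.
    exact: uniform_sphere_le Pw.
  by rewrite mulrAC.
have cvR : (pseries (radial_coef n) (enorm xi ^+ 2) N)%:E @[N --> \oo] -->
    (radial n (enorm xi))%:E.
  apply: cvg_EFin; first exact: nearW.
  exact: (exp_decaying_cvg (radial_coef_decaying n)).
rewrite /Rintegral; apply: EFin_inj.
rewrite fineK; last first.
  apply: integrable_fin_num => //.
  apply: (@bounded_integrable _ _ _ P _ 1) => [|p]; last exact: cos_max.
  exact/measurable_EFinP.
apply: (cvg_unique _ cvI) => //=; move: cvR.
by rewrite (_ : (fun N => _) = fun N => (\int[P]_p (f N p)%:E)%E)//;
  apply/funext => N; rewrite intf.
Qed.

End sphere_transform.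

(** * Lower bounds for the radial function *)

Section radial_bounds.
Context {R : realType}.

Lemma radial_norm_le1 n (r : R) : 0 <= r -> `|radial n r| <= 1.
Proof.
move=> r0; have := radial_energy_nincr n (lexx 0) r0.
rewrite radial0 mulr0 mul0r expr0n addr0 expr1n => h.
have := sqr_ge0 (2 * r * radial' n r).
move: h; move: (_ * radial' _ _) (radial n r) => v u h v0.
by rewrite ler_norml; apply/andP; split; nra.
Qed.

(** By the energy bound u'^2 <= 1 the function u is 1-Lipschitz. *)
Lemma radial_ge_sub n (r : R) : 0 <= r -> 1 - r <= radial n r.
Proof.
move=> r0.
pose f (x : R) := - (radial n x + x).
pose f' (x : R) := - (2 * x * radial' n x + 1).
have df x : is_derive x (1 : R) f (f' x).
  have D := is_derive_radial n x.
  by apply: is_derive_eq.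
have f'0 x : 0 < x -> f' x <= 0.
  move=> x0; suff : -1 <= 2 * x * radial' n x by rewrite /f'; lra.
  have := radial_energy_nincr n (lexx 0) (ltW x0).
  rewrite radial0 mulr0 mul0r expr0n addr0 expr1n.
  have := sqr_ge0 (radial n x).
  move: (radial n x) (2 * x * radial' n x) => u v; nra.
have := is_derive_nincr df f'0 (lexx 0) r0.
rewrite /f radial0; lra.
Qed.

Lemma measurable_radial n : measurable_fun [set: measurableTypeR R] (radial n).
Proof.
apply: continuous_measurable_fun => x.
apply: differentiable_continuous; apply/derivable1_diffP.
by apply: ex_derive; exact: is_derive_radial.
Qed.

(** At a vector orthogonal to the polar axis, the Fourier transform in
    dimension n + 2 is the average over the angle of the values u_n(r sin x),
    so that a lower bound valid at all radii passes to the next dimension. *)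
Lemma radial_ge_average n (a : R) :
  (forall r : R, 0 <= r -> a <= radial n r) ->
  forall r : R, 0 <= r -> a <= radial n.+1 r.
Proof.
move=> na r r0.
have [dT [T [P [w Pw]]]] := uniform_sphere_exists (R := R) n.
have [mw _ _ _] := Pw.
have Qw := uniform_sphere_polar Pw.
pose xi : Rn R n.+2 := [tuple if i == ord_max then r else 0 | i < n.+2].
have xi0 : coord xi ord0 = 0 by rewrite coord_mktuple.
have xir : enorm xi = r.
  rewrite /enorm (bigD1 ord_max)//= coord_mktuple eqxx big1 => [|i /negbTE ni].
    by rewrite addr0 sqrtr_sqr ger0_norm.
  by rewrite coord_mktuple ni expr0n.
have txir : enorm (tuple_tail xi) = r.
  have := sqr_enorm_head_tail xi; rewrite xir xi0 expr0n add0r => /esym.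
  move/eqP; rewrite eqrXn2 ?enorm_ge0//; exact/eqP.
rewrite -xir -(uniform_sphere_cos Qw).
pose g (z : measurableTypeR R * T) := cos (dotp (polar w z) xi).
have g1 z : `|g z| <= 1 by rewrite cos_max.
have mg : measurable_fun [set: measurableTypeR R * T] g.
  apply: (measurableT_comp (continuous_measurable_fun (@continuous_cos R))).
  by apply: measurable_dotp_fun => //; exact: measurable_polar Pw.
rewrite -(@Rintegral_prod1 _ _ _ _ _ (polar_prob n) P g); last 2 first.
- pose Q : probability _ R := (polar_prob n \x P)%E.
  exact: (@bounded_integrable _ _ _ Q _ 1).
- move=> x; apply: (@bounded_integrable _ _ _ P _ 1) => [|p]; last exact: g1.
  exact: (measurableT_comp mg (measurable_pair1 x)).
have inner x : \int[P]_p g (x, p) = radial n (`|sin x| * r).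
  rewrite -txir -enorm_vscale -(uniform_sphere_cos Pw).
  apply: eq_Rintegral => p _; rewrite /g dotp_polar xi0 mulr0 add0r.
  by rewrite [in RHS]dotpC dotp_vscale dotpC.
under eq_Rintegral do rewrite inner.
have mr : measurable_fun [set: measurableTypeR R] (fun x => radial n (`|sin x| * r)).
  apply: (measurableT_comp (measurable_radial n)).
  apply: measurable_funM => //; apply: measurableT_comp => //.
  exact: (continuous_measurable_fun (@continuous_sin R)).
have -> : a = \int[polar_prob n]_(x in setT) a.
  rewrite Rintegral_cst// [X in _ * X](_ : _ = 1) ?mulr1//.
  by rewrite -[RHS]/(fine 1%E); congr fine; exact: probability_setT.
apply: le_Rintegral => //.
- exact: finite_measure_integrable_cst.
- apply: (@bounded_integrable _ _ _ (polar_prob n) _ 1) => // x.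
  by rewrite radial_norm_le1 ?mulr_ge0.
- by move=> x _; rewrite na ?mulr_ge0.
Qed.

Lemma radial_ge m (r : R) : 0 <= r -> - (46 / 100) <= radial m.+1 r.
Proof.
elim: m r => [|m IH]; first exact: radial1_ge.
exact: radial_ge_average.
Qed.

End radial_bounds.

(** * Fourier transform of the Gaussian on the line *)

Section total_derivative.
Context {R : realType}.
Local Notation leb := (@lebesgue_measure R).

Lemma Rintegral_derive_eq0 (h h' : R -> R) :
  (forall x, is_derive x (1 : R) h (h' x)) -> continuous h' ->
  leb.-integrable [set: R] (EFin \o h') ->
  h n%:R @[n --> \oo] --> (0 : R) -> h (- n%:R) @[n --> \oo] --> (0 : R) ->
  \int[leb]_x h' x = 0.
Proof.
move=> dh ch inth hp hm.
pose D n : set R := `[- n%:R, n%:R]%classic.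
pose f n := (EFin \o h') \_ (D n).
have mf n : measurable_fun [set: R] (f n).
  apply: (measurable_restrictT (EFin \o h') (measurable_itv _)).1.
  apply: (measurable_funS measurableT (@subsetT _ _)).
  exact: measurable_int inth.
have cvf x : [set: R] x -> f n x @[n --> \oo] --> (h' x)%:E.
  move=> _; apply: cvg_near_cst; near=> n.
  rewrite /f patchE mem_set//; rewrite /D /= in_itv /= -ler_norml.
  by near: n; exact: nbhs_infty_ger.
have lef x n : [set: R] x -> (`|f n x| <= `|(h' x)%:E|)%E.
  by move=> _; rewrite /f patchE; case: ifPn => // _; rewrite -[point]/(0%E : \bar R) abse0 abse_ge0.
have [_ _] := @dominated_convergence _ _ _ leb setT measurableT f (EFin \o h')
  (abse \o (EFin \o h')) mf (measurable_int _ inth)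
  (aeW leb cvf) (integrable_abse inth) (aeW leb (fun x n Tx => lef x n Tx)).
have intf n : (0 < n)%N -> (\int[leb]_x f n x = (h n%:R - h (- n%:R))%:E)%E.
  move=> n0; rewrite -integral_mkcond -(Rintegral_FTC _ dh ch).
    rewrite fineK//; apply: integrable_fin_num => //.
    exact: integrableS inth.
  by rewrite -subr_gt0 opprK -natrD ltr0n addn_gt0 n0.
have cv0 : (h n%:R - h (- n%:R))%:E @[n --> \oo] --> (0 : R)%:E.
  apply: cvg_EFin; first exact: nearW.
  by rewrite -(subrr 0); exact: cvgB.
move=> cvI; rewrite /Rintegral -[RHS]/(fine 0%:E); congr fine; apply: (cvg_unique _ cvI) => //.
apply: cvg_trans cv0; apply: near_eq_cvg; near=> n.
by rewrite /= intf//; near: n; exists 1%N.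
Unshelve. all: end_near. Qed.

End total_derivative.

Section gaussian.
Context {R : realType}.
Variable s : R.
Hypothesis s0 : 0 < s.
Local Notation leb := (@lebesgue_measure R).

Let w := @normal_fun R 0 s.

Let wE x : w x = expR (- (x ^+ 2 / (s ^+ 2 *+ 2))).
Proof. by rewrite /w /normal_fun subr0 mulNr. Qed.

Lemma integrable_normal_fun (t : R) : 0 < t ->
  leb.-integrable [set: R] (EFin \o normal_fun 0 t).
Proof.
move=> t0; have tN0 : t != 0 by rewrite gt_eqF.
have p0 : normal_peak t != 0 by rewrite gt_eqF// normal_peak_gt0.
have := integrableZl measurableT (normal_peak t)^-1 (integrable_normal_pdf 0 t).
apply: eq_integrable => // x _.
by rewrite normal_pdfE//= -EFinM mulKf.
Qed.

Let mw : measurable_fun [set: R] w.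
Proof. exact: measurable_normal_fun. Qed.

Let w_ge0 x : 0 <= w x. Proof. exact: expR_ge0. Qed.

(* The moment |x| w(x) is dominated by a wider Gaussian; this majorant allows
   integration by parts and differentiation under the integral. *)
Let xw_le x : `|x| * w x <= s * normal_fun 0 (Num.sqrt 2 * s) x.
Proof.
rewrite wE /normal_fun subr0 exprMn sqr_sqrtr// mulNr.
have -> : - (x ^+ 2 / (s ^+ 2 *+ 2)) =
    - ((x / (2 * s)) ^+ 2) + - (x ^+ 2 / (2 * s ^+ 2 *+ 2)).
  by field; rewrite gt_eqF.
rewrite expRD mulrA ler_wpM2r ?expR_ge0//.
rewrite expRN ler_pdivrMr ?expR_gt0//.
apply: (@le_trans _ _ (s * (1 + (x / (2 * s)) ^+ 2))); last first.
  by rewrite ler_pM2l// expR_ge1Dx.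
have -> : s * (1 + (x / (2 * s)) ^+ 2) =
    `|x| + s * (1 - `|x| / (2 * s)) ^+ 2.
  rewrite (_ : (x / (2 * s)) ^+ 2 = (`|x| / (2 * s)) ^+ 2); last first.
    by rewrite !expr_div_n real_normK ?num_real.
  by field; rewrite gt_eqF.
by rewrite lerDl mulr_ge0 ?sqr_ge0// ltW.
Qed.

Let dw x : is_derive x (1 : R) w (- (x / s ^+ 2 * w x)).
Proof.
rewrite (_ : w = expR \o (fun x => - ((s ^+ 2 *+ 2)^-1 * x ^+ 2))); last first.
  by apply/funext => y; rewrite wE /= mulrC.
apply: is_derive_eq; rewrite /GRing.scale/=; field; rewrite gt_eqF//.
Qed.

Section frequency.
Variables z phi : R.

Let c x := cos (z * x + phi).
Let sn x := sin (z * x + phi).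

Let mc : measurable_fun [set: R] c.
Proof.
apply: (measurableT_comp (continuous_measurable_fun (@continuous_cos R))).
by apply: measurable_funD => //; exact: measurable_funM.
Qed.

Let msn : measurable_fun [set: R] sn.
Proof.
apply: (measurableT_comp (continuous_measurable_fun (@continuous_sin R))).
by apply: measurable_funD => //; exact: measurable_funM.
Qed.

Lemma integrable_gauss_cos : leb.-integrable [set: R] (EFin \o (fun x => w x * c x)).
Proof.
apply: (le_integrable measurableT _ _ (integrable_normal_fun s0)).
  by apply/measurable_EFinP; exact: measurable_funM.
move=> x _; rewrite lee_fin; change (`|w x * c x| <= `|w x|).
by rewrite normrM ler_piMr// cos_max.
Qed.

Lemma integrable_x_gauss_sin :
  leb.-integrable [set: R] (EFin \o (fun x => x * w x * sn x)).
Proof.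
have s20 : 0 < Num.sqrt 2 * s by rewrite mulr_gt0// sqrtr_gt0.
apply: (le_integrable measurableT _ _
  (integrableZl measurableT s (integrable_normal_fun s20))).
  by apply/measurable_EFinP; do 2 apply: measurable_funM => //.
move=> x _; rewrite lee_fin.
change (`|x * w x * sn x| <= `|s * normal_fun 0 (Num.sqrt 2 * s) x|).
rewrite [leRHS]ger0_norm ?mulr_ge0 ?expR_ge0 ?(ltW s0)//.
apply: le_trans (xw_le x); rewrite 2!normrM (ger0_norm (w_ge0 x)).
by rewrite ler_piMr ?mulr_ge0// sin_max.
Qed.

(** The derivative of w(x) sin(z x + phi) has integral zero over the line. *)
Lemma Rintegral_x_gauss_sin :
  \int[leb]_x (x * w x * sn x) = s ^+ 2 * z * \int[leb]_x (w x * c x).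
Proof.
pose h x := w x * sn x.
pose h' x := z * (w x * c x) - (s ^+ 2)^-1 * (x * w x * sn x).
have dh x : is_derive x (1 : R) h (h' x).
  have D := dw x; have Ds : is_derive x (1 : R) sn (z * c x).
    by apply: is_derive_eq; rewrite /GRing.scale/= addr0 mulr1 mulrC.
  by apply: is_derive_eq; rewrite /GRing.scale/= /h'; ring.
have s20 : s ^+ 2 != 0 by rewrite expf_neq0// gt_eqF.
have i1 := integrableZl measurableT z integrable_gauss_cos.
have i2 := integrableZl measurableT (s ^+ 2)^-1 integrable_x_gauss_sin.
have inth : leb.-integrable [set: R] (EFin \o h').
  by apply: eq_integrable (integrableB measurableT i1 i2).
have ch : continuous h'.
  move=> x; apply: differentiable_continuous; apply/derivable1_diffP.
  have D := dw x; have Dc : is_derive x (1 : R) c (- (z * sn x)).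
    by apply: is_derive_eq; rewrite /GRing.scale/= /sn; ring.
  have Ds : is_derive x (1 : R) sn (z * c x).
    by apply: is_derive_eq; rewrite /GRing.scale/= addr0 mulr1 mulrC.
  by rewrite /h'; apply: ex_derive.
have wle x : x != 0 -> w x <= s / `|x|.
  move=> x0; rewrite ler_pdivlMr ?normr_gt0// mulrC (le_trans (xw_le x))//.
  rewrite ler_piMr ?(ltW s0)// /normal_fun -expR0 ler_expR mulNr oppr_le0.
  by rewrite divr_ge0 ?sqr_ge0// mulrn_wge0// sqr_ge0.
have hle n (e : bool) : `|h ((-1) ^+ e * n.+1%:R)| <= s * n.+1%:R^-1.
  have x0 : (-1) ^+ e * n.+1%:R != 0 :> R.
    by rewrite mulf_neq0 ?signr_eq0// pnatr_eq0.
  rewrite /h normrM (ger0_norm (w_ge0 _)) (le_trans _ (le_trans (wle _ x0) _))//.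
    by rewrite ler_piMr// sin_max.
  by rewrite normrM normrX normrN1 expr1n mul1r normr_nat.
have cvh (e : bool) : h ((-1) ^+ e * n%:R) @[n --> \oo] --> (0 : R).
  apply: norm_cvg0; rewrite -cvg_shiftS.
  apply: (@squeeze_cvgr _ _ _ _ (cst 0) (fun n => s * n.+1%:R^-1)).
  - by apply: nearW => n; apply/andP; split; [exact: normr_ge0|exact: hle].
  - exact: cvg_cst.
  - rewrite -(mulr0 s); apply: cvgM; [exact: cvg_cst|exact: cvg_harmonic].
have hp : h n%:R @[n --> \oo] --> (0 : R).
  by have := cvh false; under eq_fun do rewrite expr0 mul1r.
have hm : h (- n%:R) @[n --> \oo] --> (0 : R).
  by have := cvh true; under eq_fun do rewrite expr1 mulN1r.
have := Rintegral_derive_eq0 dh ch inth hp hm.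
rewrite /h' RintegralB// RintegralZl; [|by []|exact: integrable_gauss_cos].
rewrite RintegralZl; [|by []|exact: integrable_x_gauss_sin].
move=> /eqP; rewrite subr_eq0 => /eqP e.
by rewrite -mulrA e mulVKf.
Qed.

End frequency.

Lemma is_derive_gauss_transform (phi z : R) :
  is_derive z (1 : R) (fun z => \int[leb]_x (w x * cos (z * x + phi)))
    (- (s ^+ 2 * z * \int[leb]_x (w x * cos (z * x + phi)))).
Proof.
pose f (z x : R) := w x * cos (z * x + phi).
pose G x := s * normal_fun 0 (Num.sqrt 2 * s) x.
have s20 : 0 < Num.sqrt 2 * s by rewrite mulr_gt0// sqrtr_gt0.
have G0 x : 0 <= G x by rewrite mulr_ge0 ?expR_ge0// ltW.
have intG : leb.-integrable [set: R] (EFin \o G).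
  by apply: eq_integrable (integrableZl measurableT s (integrable_normal_fun s20)).
have d1f (y x : R) : is_derive y (1 : R) (f ^~ x) (- (x * w x * sin (y * x + phi))).
  by apply: is_derive_eq; rewrite /GRing.scale/=; ring.
have zI : (`]z - 1, z + 1[%classic : set R) z.
  by rewrite /= in_itv/=; apply/andP; split; lra.
have intf (y : R) : (`]z - 1, z + 1[%classic : set R) y ->
    leb.-integrable [set: R] (EFin \o f y).
  by move=> _; exact: integrable_gauss_cos.
have derf (y x : R) : (`]z - 1, z + 1[%classic : set R) y -> [set: R] x ->
    derivable (f ^~ x) y 1.
  by move=> _ _; exact: ex_derive.
have Gub (y x : R) : (`]z - 1, z + 1[%classic : set R) y -> [set: R] x ->
    `|partial1of2 f y x| <= G x.
  move=> _ _; rewrite partial1of2E derive_val normrN 2!normrM (ger0_norm (w_ge0 x)).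
  by apply: le_trans (xw_le x); rewrite ler_piMr ?mulr_ge0// sin_max.
have dF := derivable_under_integral measurableT zI intf derf G0 intG Gub.
have F' := differentiation_under_integral measurableT zI intf derf G0 intG Gub.
apply: DeriveDef; first exact: dF.
rewrite -derive1E; apply: etrans F' _.
rewrite -Rintegral_x_gauss_sin -mulN1r -RintegralZl//; last first.
  exact: integrable_x_gauss_sin.
by apply: eq_Rintegral => x _; rewrite partial1of2E derive_val mulN1r.
Qed.

Definition gauss_mass : R := \int[leb]_x w x.

(** The transform solves y' = - s^2 z y in the frequency z. *)
Lemma gauss_transform (phi z : R) :
  \int[leb]_x (w x * cos (z * x + phi)) =
  gauss_mass * expR (- (s ^+ 2 * z ^+ 2 / 2)) * cos phi.
Proof.
pose f z := \int[leb]_x (w x * cos (z * x + phi)).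
pose k z := expR (s ^+ 2 / 2 * z ^+ 2) * f z.
have dk y : is_derive y (1 : R) k 0.
  have D := is_derive_gauss_transform phi y.
  by apply: is_derive_eq; rewrite /GRing.scale/= /f; field.
have := is_derive_0_is_cst z 0 dk.
have -> : k 0 = gauss_mass * cos phi.
  rewrite /k expr0n mulr0 expR0 mul1r /f -RintegralZr//; last first.
    exact: integrable_normal_fun.
  by apply: eq_Rintegral => x _; rewrite mul0r add0r.
rewrite /k -/(f z) => e.
by rewrite mulrAC -e mulrAC (_ : s ^+ 2 * z ^+ 2 / 2 = s ^+ 2 / 2 * z ^+ 2)
  ?expRxMexpNx_1 ?mul1r//; ring.
Qed.

End gaussian.

(** * Fourier transform of the Gaussian in several variables *)

Section lebesgue_cons_integral.
Context {R : realType} {n : nat}.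
Local Notation leb := (@lebesgue_measure R).
Variable F : Rn R n.+1 -> R.
Hypothesis mF : measurable_fun [set: _] F.
Let m := lebesgue_Rn R n.

Lemma integrable_lebesgue_cons :
  (leb \x m)%E.-integrable setT (EFin \o (F \o cons_pair (n := n))) ->
  (lebesgue_Rn R n.+1).-integrable setT (EFin \o F).
Proof.
move=> iF; have mc := @measurable_cons_pair R n.
have mEF : measurable_fun [set: Rn R n.+1] (EFin \o F) by exact/measurable_EFinP.
have iF' := integrable_pushforward mc mEF (D := setT) (mu := (leb \x m)%E).
apply/integrableP; split => //.
have /integrableP[_] : (pushforward (leb \x m)%E (cons_pair (n := n))).-integrable setT (EFin \o F).
  exact: iF'.
by rewrite (eq_measure_integral (lebesgue_Rn R n.+1)).
Qed.

Lemma Rintegral_lebesgue_cons :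
  (leb \x m)%E.-integrable setT (EFin \o (F \o cons_pair (n := n))) ->
  \int[lebesgue_Rn R n.+1]_x F x = \int[(leb \x m)%E]_z F (cons_pair z).
Proof.
move=> iF; have mc := @measurable_cons_pair R n.
have mEF : measurable_fun [set: Rn R n.+1] (EFin \o F) by exact/measurable_EFinP.
have := integral_pushforward mc mEF iF measurableT.
by rewrite /Rintegral => <-; congr fine.
Qed.

End lebesgue_cons_integral.

Lemma integrable_prodM (R : realType) d1 d2 (T1 : measurableType d1)
    (T2 : measurableType d2) (m1 : {sigma_finite_measure set T1 -> \bar R})
    (m2 : {sigma_finite_measure set T2 -> \bar R}) (f : T1 -> R) (g : T2 -> R) :
  m1.-integrable setT (EFin \o f) -> m2.-integrable setT (EFin \o g) ->
  (m1 \x m2)%E.-integrable setT (EFin \o (fun z => f z.1 * g z.2)).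
Proof.
move=> intf intg.
have mf : measurable_fun setT f by apply/measurable_EFinP; exact: measurable_int intf.
have mg : measurable_fun setT g by apply/measurable_EFinP; exact: measurable_int intg.
apply/integrable12ltyP.
  apply/measurable_EFinP; apply: measurable_funM.
    exact: (measurableT_comp mf measurable_fst).
  exact: (measurableT_comp mg measurable_snd).
have /integrableP[_ foo] := intf; have /integrableP[_ goo] := intg.
rewrite /=; under eq_integral => x _.
  under eq_integral do rewrite normrM EFinM.
  rewrite ge0_integralZl//; last first.
    by apply/measurable_EFinP; exact: measurableT_comp.
  over.
rewrite ge0_integralZr//; last 2 first.
- by apply/measurable_EFinP; exact: measurableT_comp.
- exact: integral_ge0.
by apply: lte_mul_pinfty; [exact: integral_ge0|rewrite ge0_fin_numE//; exact: integral_ge0|].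
Qed.

Section gaussian_Rn.
Context {R : realType}.
Variable s : R.
Hypothesis s0 : 0 < s.
Local Notation leb := (@lebesgue_measure R).

Definition gauss_weight n (xi : Rn R n) : R :=
  expR (- (enorm xi ^+ 2 / (s ^+ 2 *+ 2))).

Lemma measurable_gauss_weight n : measurable_fun [set: Rn R n] (@gauss_weight n).
Proof.
apply: (measurableT_comp (@measurable_expR R)).
apply: measurableT_comp => //; apply: measurable_funM => //.
by apply: measurable_funX; exact: measurable_enorm_fun.
Qed.

Lemma coord_cons_pair0 n (p : measurableTypeR R * Rn R n) :
  coord (cons_pair p) ord0 = p.1.
Proof. exact: tnth0. Qed.

Lemma coord_cons_pairS n (p : measurableTypeR R * Rn R n) i :
  coord (cons_pair p) (lift ord0 i) = coord p.2 i.
Proof. by rewrite /coord tnthS; congr tnth; apply: val_inj. Qed.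

Lemma sqr_enorm_cons_pair n (p : measurableTypeR R * Rn R n) :
  enorm (cons_pair p) ^+ 2 = p.1 ^+ 2 + enorm p.2 ^+ 2.
Proof.
rewrite !sqr_enorm big_ord_recl coord_cons_pair0; congr (_ + _).
by apply: eq_bigr => i _; rewrite coord_cons_pairS.
Qed.

Lemma dotp_cons_pair n z (p : measurableTypeR R * Rn R n) :
  dotp z (cons_pair p) = coord z ord0 * p.1 + dotp (tuple_tail z) p.2.
Proof.
rewrite /dotp big_ord_recl coord_cons_pair0; congr (_ + _).
by apply: eq_bigr => i _; rewrite coord_cons_pairS coord_mktuple.
Qed.

Lemma gauss_weight_cons n (p : measurableTypeR R * Rn R n) :
  gauss_weight (cons_pair p) = normal_fun 0 s p.1 * gauss_weight p.2.
Proof.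
rewrite /gauss_weight sqr_enorm_cons_pair /normal_fun subr0 -expRD.
by congr expR; ring.
Qed.

Lemma integrable_gauss_weight n :
  (lebesgue_Rn R n).-integrable setT (EFin \o @gauss_weight n).
Proof.
elim: n => [|n IH].
  apply/integrableP; split; first by apply/measurable_EFinP; exact: measurable_gauss_weight.
  rewrite /= integral_dirac//; last first.
    by apply/measurable_EFinP; apply: measurableT_comp => //; exact: measurable_gauss_weight.
  by rewrite diracT mul1e ltry.
apply: integrable_lebesgue_cons; first exact: measurable_gauss_weight.
apply: eq_integrable (integrable_prodM (integrable_normal_fun s0) IH) => // p _.
by rewrite /= gauss_weight_cons.
Qed.

(** The phase phi makes an induction on the dimension possible: one coordinate
    at a time is moved into it. *)
Lemma gauss_weight_transform n (z : Rn R n) phi :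
  \int[lebesgue_Rn R n]_xi (gauss_weight xi * cos (dotp z xi + phi)) =
  gauss_mass s ^+ n * expR (- (s ^+ 2 * enorm z ^+ 2 / 2)) * cos phi.
Proof.
have mF k (y : Rn R k) a : measurable_fun [set: Rn R k]
    (fun xi => gauss_weight xi * cos (dotp y xi + a)).
  apply: measurable_funM; first exact: measurable_gauss_weight.
  apply: (measurableT_comp (continuous_measurable_fun (@continuous_cos R))).
  by apply: measurable_funD => //; exact: measurable_dotp_fun.
elim: n z phi => [|n IH] z phi.
  rewrite /Rintegral /= integral_dirac//; last by apply/measurable_EFinP; exact: mF.
  rewrite diracT mul1e /= expr0 mul1r sqr_enorm big_ord0 mulr0 mul0r oppr0.
  by rewrite /dotp big_ord0 add0r /gauss_weight sqr_enorm big_ord0 mul0r oppr0.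
have iprod := integrable_prodM (integrable_normal_fun s0) (integrable_gauss_weight n).
pose F (p : measurableTypeR R * Rn R n) := normal_fun 0 s p.1 *
  (gauss_weight p.2 * cos (dotp (tuple_tail z) p.2 + (coord z ord0 * p.1 + phi))).
have FE p : gauss_weight (cons_pair p) * cos (dotp z (cons_pair p) + phi) = F p.
  rewrite gauss_weight_cons dotp_cons_pair /F mulrA; congr (_ * cos _); ring.
have nfM (a b : R) : `|normal_fun 0 s a * b| = normal_fun 0 s a * `|b|.
  by rewrite normrM ger0_norm ?expR_ge0.
have gwM (xi : Rn R n) (b : R) : `|gauss_weight xi * b| = gauss_weight xi * `|b|.
  by rewrite normrM ger0_norm ?expR_ge0.
have intF : (leb \x lebesgue_Rn R n)%E.-integrable setT (EFin \o F).
  apply: (le_integrable measurableT _ _ iprod).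
    apply/measurable_EFinP; rewrite (_ : F = fun p =>
        gauss_weight (cons_pair p) * cos (dotp z (cons_pair p) + phi)).
      exact: (measurableT_comp (mF _ z phi) (@measurable_cons_pair R n)).
    by apply/funext => p; rewrite FE.
  move=> p _; rewrite lee_fin /= nfM gwM nfM ler_pM2l ?expR_gt0//.
  by rewrite [leRHS]ger0_norm ?expR_ge0// ler_piMr ?expR_ge0// cos_max.
rewrite Rintegral_lebesgue_cons; [|exact: mF|]; last first.
  by apply: eq_integrable intF => // p _; rewrite /= FE.
under eq_Rintegral do rewrite FE.
have intx (a : R) : (lebesgue_Rn R n).-integrable setT (EFin \o (fun xi =>
    gauss_weight xi * cos (dotp (tuple_tail z) xi + (coord z ord0 * a + phi)))).
  apply: (le_integrable measurableT _ _ (integrable_gauss_weight n)).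
    by apply/measurable_EFinP; exact: mF.
  move=> xi _; rewrite lee_fin /= gwM.
  by rewrite [leRHS]ger0_norm ?expR_ge0// ler_piMr ?expR_ge0// cos_max.
rewrite -Rintegral_prod1//; last first.
  by move=> a; apply: eq_integrable (integrableZl measurableT (normal_fun 0 s a) (intx a)).
rewrite /F; under eq_Rintegral => a _.
  rewrite /= RintegralZl// IH mulrCA.
  over.
rewrite RintegralZl//; last exact: integrable_gauss_cos.
rewrite gauss_transform// (sqr_enorm_head_tail z).
set E1 := expR _; set E2 := expR (- (_ * _ ^+ 2 / 2)).
set E3 := expR _.
have -> : E3 = E1 * E2 by rewrite /E3 -expRD; congr expR; field.
by rewrite [gauss_mass s ^+ n.+1]exprS; ring.
Qed.

End gaussian_Rn.

(** * Compactness of the support *)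

Section support.
Context {R : realType} {d : nat}.
Variable mu : probability (Rn R d) R.

Definition eball (x : Rn R d) (r : R) : set (Rn R d) := [set y | edist x y < r].

Lemma measurable_eball x r : measurable (eball x r).
Proof.
have mE : measurable_fun [set: Rn R d] (fun y => edist x y).
  exact: measurable_edist_fun.
have := mE measurableT _ (measurable_itv `]-oo, r[).
by rewrite setTI; congr (measurable _); apply/seteqP; split => y /=; rewrite in_itv.
Qed.

Lemma not_supportP x : ~ measure_support mu x ->
  exists2 r : R, 0 < r & mu (eball x r) = 0%E.
Proof.
move=> /existsNP[r /not_implyP[r0 /negP]]; rewrite -leNgt measure_le0 => /eqP.
by exists r.
Qed.

Lemma eball_sub_not_support x y (r : R) : mu (eball x r) = 0%E ->
  eball x r y -> ~ measure_support mu y.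
Proof.
move=> mu0 xy /(_ (r - edist x y)).
rewrite subr_gt0 => /(_ xy); apply/negP; rewrite -leNgt -mu0.
apply: le_measure; rewrite ?inE; try exact: measurable_eball.
move=> z; rewrite /eball /= ltrBrDl => yz.
exact: le_lt_trans (edist_triangle y x z) yz.
Qed.

(* The denominator d + 1, rather than d, covers d = 0. *)
Lemma edist_lt_coord (x y : Rn R d) (e : R) : 0 < e ->
  (forall i, `|coord x i - coord y i| < e / d.+1%:R) -> edist x y < e.
Proof.
move=> e0 xy; have eta0 : 0 <= e / d.+1%:R by rewrite ltW// divr_gt0.
rewrite -[ltRHS](ger0_norm (ltW e0)) -[ltRHS]sqrtr_sqr ltr_sqrt ?exprn_gt0//.
apply: (@le_lt_trans _ _ (\sum_(i < d) (e / d.+1%:R) ^+ 2)).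
  apply: ler_sum => i _; rewrite -real_normK ?num_real// lerXn2r ?nnegrE//.
  exact: ltW.
rewrite sumr_const card_ord -[ltLHS]mulr_natr expr_div_n -mulrA gtr_pMr ?exprn_gt0//.
rewrite mulrC ltr_pdivrMr ?exprn_gt0// mul1r expr2 -natrM ltr_nat.
by rewrite mulnS ltn_addr.
Qed.

Lemma rat_tuple_near x (e : R) : 0 < e ->
  exists q : d.-tuple rat, edist x [tuple ratr (tnth q i) | i < d] < e.
Proof.
move=> e0; pose eta := e / d.+1%:R.
have eta0 : 0 < eta by rewrite divr_gt0.
have /choice[q qx] (i : 'I_d) : exists q : rat, `|coord x i - ratr q| < eta.
  have [|q] := @rat_in_itvoo R (coord x i - eta) (coord x i + eta).
    by rewrite ltrD2l gtrN.
  by rewrite in_itv/= => /andP[q1 q2]; exists q; rewrite ltr_norml; apply/andP; split; lra.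
exists [tuple q i | i < d]; apply: edist_lt_coord => // i.
by rewrite coord_mktuple tnth_mktuple.
Qed.

(** Lindelof's argument: the complement of the support is covered by countably
    many null balls, with rational centres and radii 1/(k+1). *)
Lemma negligible_not_support : mu.-negligible (~` measure_support mu).
Proof.
pose B (qk : d.-tuple rat * nat) : set (Rn R d) :=
  eball [tuple ratr (tnth qk.1 i) | i < d] qk.2.+1%:R^-1.
pose G (m : nat) : set (Rn R d) :=
  if unpickle m is Some qk then
    if mu (B qk) == 0%E then B qk else set0 else set0.
apply: (@negligibleS _ _ _ _ (\bigcup_m G m)).
  move=> x /not_supportP[r r0 mu0].
  have [k _ kr] : exists2 k : nat, True & k.+1%:R^-1 < r / 2.
    have [k kr] := @ltr_add_invr R 0 (r / 2) (divr_gt0 r0 (ltr0n _ 2)).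
    by exists k; rewrite ?add0r in kr *.
  have [q xq] : exists q : d.-tuple rat,
      edist x [tuple ratr (tnth q i) | i < d] < k.+1%:R^-1.
    by apply: rat_tuple_near; rewrite invr_gt0.
  exists (pickle (q, k)) => //; rewrite /G pickleK.
  have Bx : B (q, k) `<=` eball x r.
    move=> y /=; rewrite /B /eball /= => qy.
    apply: (le_lt_trans (edist_triangle [tuple ratr (tnth q i) | i < d] x y)).
    by rewrite (splitr r) ltrD//; [exact: lt_trans xq kr|exact: lt_trans qy kr].
  have -> : mu (B (q, k)) = 0%E.
    apply/eqP; rewrite -measure_le0 -mu0 le_measure ?inE//; exact: measurable_eball.
  by rewrite eqxx /B /eball /= edist_sym.
apply: negligible_bigcup => m; rewrite /G.
case: (unpickle m) => [qk|]; last exact: negligible_set0.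
case: ifPn => [/eqP B0|_]; last exact: negligible_set0.
by exists (B qk); split => //; exact: measurable_eball.
Qed.

(* Row vectors carry the product topology, in which the cube is compact. *)
Let toT (u : 'rV[R]_d) : Rn R d := [tuple u ord0 i | i < d].

Let toT_near (u : 'rV[R]_d) (e : R) : 0 < e ->
  \forall u' \near u, edist (toT u) (toT u') < e.
Proof.
move=> e0.
pose A (i : 'I_d) : set 'rV[R]_d := fun u' => `|u ord0 i - u' ord0 i| < e / d.+1%:R.
have : \forall u' \near u, [set v | forall i, A i v] u'.
  apply: (@filter_forall _ _ A (nbhs u)) => i.
  have := @coord_continuous R 1 d ord0 i u.
  by move/cvgrPdist_lt; apply; rewrite divr_gt0.
apply: filterS => u' uu'; apply: edist_lt_coord => // i.
by have := uu' i; rewrite /toT !coord_mktuple.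
Qed.

(** The support is a compact set, on whose square the continuous function
    |dist(x, y) - t| has no zero. *)
Lemma support_dist_gap (t : R) :
  measure_support mu `<=` unit_cube ->
  (forall x y, measure_support mu x -> measure_support mu y -> edist x y != t) ->
  exists2 c : R, 0 < c & forall x y, measure_support mu x ->
    measure_support mu y -> c <= `|edist x y - t|.
Proof.
move=> sub nt.
pose I01 (i : 'I_d) : set R := `[0, 1]%classic.
pose K1 : set 'rV[R]_d := [set u : 'rV[R]_d | forall i, I01 i (u ord0 i)].
have cK1 : compact K1.
  by apply: (@rV_compact R d I01) => i; exact: segment_compact.
have cK := compact_setX cK1 cK1.
pose P (c : R) (uv : 'rV[R]_d * 'rV[R]_d) :=
  measure_support mu (toT uv.1) -> measure_support mu (toT uv.2) ->
  c <= `|edist (toT uv.1) (toT uv.2) - t|.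
have off u : ~ measure_support mu (toT u) ->
    \forall u' \near u, ~ measure_support mu (toT u').
  move=> /not_supportP[r r0 mu0]; apply: filterS (toT_near u r0) => u' uu'.
  exact: eball_sub_not_support uu'.
have := (compact_near_coveringP _).1 cK _ (0^'+ : set_system R) P _.
have cov : forall uv, (K1 `*` K1) uv ->
    \forall uv' \near uv & c \near (0^'+ : set_system R), P c uv'.
  move=> [u v] _.
  have near1 (A : set 'rV[R]_d) : (\forall u' \near u, A u') ->
    \forall uv' \near (u, v), A uv'.1 by exact: cvg_fst.
  have near2 (A : set 'rV[R]_d) : (\forall v' \near v, A v') ->
    \forall uv' \near (u, v), A uv'.2 by exact: cvg_snd.
  have [su|/off/near1 nsu] := pselect (measure_support mu (toT u)); last first.
    near=> uv' c => s1 _; exfalso; apply: (_ : ~ measure_support mu (toT uv'.1)) s1.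
    by near: uv'.
  have [sv|/off/near2 nsv] := pselect (measure_support mu (toT v)); last first.
    near=> uv' c => _ s2; exfalso; apply: (_ : ~ measure_support mu (toT uv'.2)) s2.
    by near: uv'.
  pose e := `|edist (toT u) (toT v) - t| / 4.
  have e0 : 0 < e by rewrite divr_gt0// normr_gt0 subr_eq0 nt.
  have nu := near1 _ (toT_near u e0); have nv := near2 _ (toT_near v e0).
  near=> uv' c => _ _.
  have ue : edist (toT u) (toT uv'.1) < e.
    by near: uv'.
  have ve : edist (toT v) (toT uv'.2) < e.
    by near: uv'.
  have ce : c <= e by near: c; exact: nbhs_right_le.
  have t1 := edist_triangle (toT uv'.1) (toT u) (toT v).
  have t2 := edist_triangle (toT uv'.2) (toT uv'.1) (toT v).
  have t3 := edist_triangle (toT u) (toT uv'.1) (toT uv'.2).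
  have t4 := edist_triangle (toT v) (toT u) (toT uv'.2).
  rewrite (edist_sym (toT uv'.2) (toT v)) in t2.
  rewrite (edist_sym (toT uv'.1) (toT u)) in t3.
  have e4 : 4 * e = `|edist (toT u) (toT v) - t| by rewrite /e; field.
  have dd : `|edist (toT u) (toT v) - edist (toT uv'.1) (toT uv'.2)| <= e + e.
    by rewrite ler_norml; apply/andP; split; move: t1 t2 t3 t4 ue ve; clear; lra.
  have := ler_normD (edist (toT u) (toT v) - edist (toT uv'.1) (toT uv'.2))
    (edist (toT uv'.1) (toT uv'.2) - t).
  rewrite addrA subrK -e4 -lerBlDl; apply: le_trans; apply: (le_trans ce).
  by rewrite lerBrDr (le_trans (lerD (lexx e) dd))//; have e0' := e0;
    move: e0'; clear; lra.
move=> /(_ _ cov) H.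
have [c [c0 cP]] : exists c : R, 0 < c /\ (K1 `*` K1 `<=` P c).
  near ((0 : R)^'+) => c; exists c; split; last by near: c.
  by near: c; exact: nbhs_right_gt.
exists c => // x y sx sy.
pose fromT (x : Rn R d) : 'rV[R]_d := \row_i coord x i.
have fromTK x' : toT (fromT x') = x'.
  by apply: eq_from_tnth => i; rewrite tnth_mktuple mxE.
have inK x' : measure_support mu x' -> K1 (fromT x').
  by move=> /sub x01 i; rewrite /I01 /= in_itv/= mxE; exact: x01.
have := cP (fromT x, fromT y); rewrite /P /= !fromTK; apply => //.
by split; exact: inK.
Unshelve. all: end_near. Qed.

End support.

(** * The power spectrum of a measure *)

Section power_spectrum.
Context {R : realType} {d : nat}.
Variable mu : probability (Rn R d) R.
Let Rd := Rn R d.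

Definition spectrum (xi : Rd) : R :=
  ComplexField.Normc.normc (fourier mu xi) ^+ 2.

Definition cos_transform (xi : Rd) : R := \int[mu]_x cos (dotp x xi).
Definition sin_transform (xi : Rd) : R := \int[mu]_x sin (dotp x xi).

Lemma measurable_cos_dotp dT (T : measurableType dT) (f g : T -> Rd) :
  measurable_fun [set: T] f -> measurable_fun [set: T] g ->
  measurable_fun [set: T] (fun x => cos (dotp (f x) (g x))).
Proof.
move=> mf mg.
apply: (measurableT_comp (continuous_measurable_fun (@continuous_cos R))).
exact: measurable_dotp_fun.
Qed.

Lemma measurable_sin_dotp dT (T : measurableType dT) (f g : T -> Rd) :
  measurable_fun [set: T] f -> measurable_fun [set: T] g ->
  measurable_fun [set: T] (fun x => sin (dotp (f x) (g x))).
Proof.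
move=> mf mg.
apply: (measurableT_comp (continuous_measurable_fun (@continuous_sin R))).
exact: measurable_dotp_fun.
Qed.

Lemma spectrumE xi : spectrum xi = cos_transform xi ^+ 2 + sin_transform xi ^+ 2.
Proof.
rewrite /spectrum /fourier /cintegral /ComplexField.Normc.normc.
rewrite sqr_sqrtr; last by rewrite addr_ge0 ?sqr_ge0.
have -> : \int[mu]_x complex.Re (cis (- dotp x xi)) = cos_transform xi.
  by apply: eq_Rintegral => x _; rewrite /cis /= cosN.
have -> // : \int[mu]_x complex.Im (cis (- dotp x xi)) = - sin_transform xi.
  rewrite -mulN1r -RintegralZl//; last first.
    apply: (@bounded_integrable _ _ _ mu _ 1) => [|x]; last exact: sin_max.
    exact: measurable_sin_dotp.
  by apply: eq_Rintegral => x _; rewrite /cis /= sinN mulN1r.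
by rewrite sqrrN.
Qed.

Lemma spectrum_ge0 xi : 0 <= spectrum xi.
Proof. by rewrite spectrumE addr_ge0 ?sqr_ge0. Qed.

End power_spectrum.

Section convolution.
Context {R : realType} {d : nat}.
Variable mu : probability (Rn R d) R.
Let Rd := Rn R d.

Let mumu : probability (Rd * Rd)%type R := (mu \x mu)%E.

Lemma cos_transform_difference xi :
  \int[mumu]_z cos (dotp z.1 xi - dotp z.2 xi) = spectrum mu xi.
Proof.
have mc : measurable_fun [set: Rd] (fun x => cos (dotp x xi)) by exact: measurable_cos_dotp.
have ms : measurable_fun [set: Rd] (fun x => sin (dotp x xi)) by exact: measurable_sin_dotp.
have c1 x : `|cos (dotp x xi)| <= 1 by exact: cos_max.
have s1 x : `|sin (dotp x xi)| <= 1 by exact: sin_max.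
under eq_Rintegral do rewrite cosB.
rewrite RintegralD//.
- rewrite (Rintegral_prodM mu mu mc mc c1 c1) (Rintegral_prodM mu mu ms ms s1 s1).
  by rewrite spectrumE !expr2.
- apply: (@bounded_integrable _ _ _ mumu _ (1 * 1)) => [|z].
    apply: measurable_funM.
      exact: (measurableT_comp mc measurable_fst).
    exact: (measurableT_comp mc measurable_snd).
  by rewrite normrM ler_pM.
- apply: (@bounded_integrable _ _ _ mumu _ (1 * 1)) => [|z].
    apply: measurable_funM.
      exact: (measurableT_comp ms measurable_fst).
    exact: (measurableT_comp ms measurable_snd).
  by rewrite normrM ler_pM.
Qed.

Lemma sin_transform_difference xi :
  \int[mumu]_z sin (dotp z.1 xi - dotp z.2 xi) = 0.
Proof.
have mc : measurable_fun [set: Rd] (fun x => cos (dotp x xi)) by exact: measurable_cos_dotp.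
have ms : measurable_fun [set: Rd] (fun x => sin (dotp x xi)) by exact: measurable_sin_dotp.
have c1 x : `|cos (dotp x xi)| <= 1 by exact: cos_max.
have s1 x : `|sin (dotp x xi)| <= 1 by exact: sin_max.
under eq_Rintegral do rewrite sinB.
rewrite RintegralB//.
- rewrite (Rintegral_prodM mu mu ms mc s1 c1) (Rintegral_prodM mu mu mc ms c1 s1).
  by rewrite mulrC subrr.
- apply: (@bounded_integrable _ _ _ mumu _ (1 * 1)) => [|z].
    apply: measurable_funM.
      exact: (measurableT_comp ms measurable_fst).
    exact: (measurableT_comp mc measurable_snd).
  by rewrite normrM ler_pM.
- apply: (@bounded_integrable _ _ _ mumu _ (1 * 1)) => [|z].
    apply: measurable_funM.
      exact: (measurableT_comp mc measurable_fst).
    exact: (measurableT_comp ms measurable_snd).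
  by rewrite normrM ler_pM.
Qed.

Lemma spectrum_le1 xi : spectrum mu xi <= 1.
Proof.
have -> : (1 : R) = \int[mumu]_(z in setT) 1.
  rewrite Rintegral_cst// [X in _ * X](_ : _ = 1) ?mulr1//.
  by rewrite -[RHS]/(fine 1%E); congr fine; exact: probability_setT.
rewrite -cos_transform_difference; apply: le_Rintegral => //.
- apply: (@bounded_integrable _ _ _ mumu _ 1) => [|z]; last exact: cos_max.
  apply: (measurableT_comp (continuous_measurable_fun (@continuous_cos R))).
  apply: measurable_funB; apply: measurable_dotp_fun => //.
- exact: finite_measure_integrable_cst.
Qed.

Lemma measurable_spectrum : measurable_fun [set: Rd] (spectrum mu).
Proof.
have meas (f : R -> R) : continuous f -> (forall y, `|f y| <= 1) ->
    measurable_fun [set: Rd] (fun xi => \int[mu]_x f (dotp x xi)).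
  move=> cf f1; pose F (z : Rd * Rd) := f (dotp z.2 z.1).
  have mF : measurable_fun [set: Rd * Rd] F.
    apply: (measurableT_comp (continuous_measurable_fun cf)).
    exact: measurable_dotp_fun.
  have intF : (mu \x mu)%E.-integrable setT (EFin \o F).
    by apply: (@bounded_integrable _ _ _ mumu _ 1) => // z; exact: f1.
  have := measurable_fubini_F intF.
  by move=> mfub; apply: (measurableT_comp _ mfub).
rewrite (_ : spectrum mu = fun xi => cos_transform mu xi ^+ 2 + sin_transform mu xi ^+ 2).
  apply: measurable_funD; apply: measurable_funX; apply: meas.
  - exact: continuous_cos.
  - exact: cos_max.
  - exact: continuous_sin.
  - exact: sin_max.
by apply/funext => xi; exact: spectrumE.
Qed.

End convolution.

(** * The chord vector and a missing distance *)

Section sphere_convolution.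
Context {R : realType} {n : nat} {dT} {T : measurableType dT}.
Variable mu : probability (Rn R n.+1) R.
Variables (P : probability T R) (w : T -> Rn R n.+1).
Hypothesis Pw : uniform_sphere P w.
Variable t : R.
Hypothesis t0 : 0 < t.
Let Rd := Rn R n.+1.
Let Om := (Rd * Rd * T)%type.

Let mumu : probability (Rd * Rd)%type R := (mu \x mu)%E.
Let Q : probability Om R := (mumu \x P)%E.

Definition chord (q : Om) : Rd :=
  [tuple coord q.1.1 i - coord q.1.2 i - t * coord (w q.2) i | i < n.+1].

Lemma dotp_chord q xi :
  dotp (chord q) xi = (dotp q.1.1 xi - dotp q.1.2 xi) - t * dotp (w q.2) xi.
Proof.
rewrite /dotp mulr_sumr -!sumrB; apply: eq_bigr => i _.
by rewrite coord_mktuple; ring.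
Qed.

Let m1 : measurable_fun [set: Om] (fun q => q.1.1).
Proof. exact: (measurableT_comp measurable_fst measurable_fst). Qed.
Let m2 : measurable_fun [set: Om] (fun q => q.1.2).
Proof. exact: (measurableT_comp measurable_snd measurable_fst). Qed.
Let mw : measurable_fun [set: Om] (fun q => w q.2).
Proof. by have [mw _ _ _] := Pw; exact: (measurableT_comp mw measurable_snd). Qed.

Lemma measurable_chord : measurable_fun [set: Om] chord.
Proof.
apply: measurable_mktuple => i; apply: measurable_funB.
  apply: measurable_funB.
    exact: (measurableT_comp (measurable_coord i) m1).
  exact: (measurableT_comp (measurable_coord i) m2).
apply: measurable_funM => //; exact: (measurableT_comp (measurable_coord i) mw).
Qed.

(** The three points are independent, and x - y is symmetric: its transform
    is real, so the product of the sines contributes nothing. *)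
Lemma cos_transform_chord xi :
  \int[Q]_q cos (dotp (chord q) xi) = spectrum mu xi * radial n (t * enorm xi).
Proof.
have [mwT _ _ _] := Pw.
pose a (z : Rd * Rd) := dotp z.1 xi - dotp z.2 xi.
pose b (p : T) := t * dotp (w p) xi.
have ma : measurable_fun [set: Rd * Rd] a.
  by apply: measurable_funB; exact: measurable_dotp_fun.
have mb : measurable_fun [set: T] b.
  by apply: measurable_funM => //; exact: measurable_dotp_fun.
have mC d' (X : measurableType d') (f : X -> R) : measurable_fun setT f ->
    measurable_fun setT (cos \o f).
  exact: (measurableT_comp (continuous_measurable_fun (@continuous_cos R))).
have mS d' (X : measurableType d') (f : X -> R) : measurable_fun setT f ->
    measurable_fun setT (sin \o f).
  exact: (measurableT_comp (continuous_measurable_fun (@continuous_sin R))).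
have c1 (X : Type) (f : X -> R) x : `|(cos \o f) x| <= 1 by exact: cos_max.
have s1 (X : Type) (f : X -> R) x : `|(sin \o f) x| <= 1 by exact: sin_max.
have int (f g : R -> R) : measurable_fun setT (f \o a) -> measurable_fun setT (g \o b) ->
    (forall x, `|f x| <= 1) -> (forall x, `|g x| <= 1) ->
    Q.-integrable setT (EFin \o (fun q : Om => (f \o a) q.1 * (g \o b) q.2)).
  move=> mf mg f1 g1.
  apply: (@bounded_integrable _ _ _ Q _ (1 * 1)) => [|z].
    apply: measurable_funM.
      exact: (measurableT_comp mf measurable_fst).
    exact: (measurableT_comp mg measurable_snd).
  by rewrite /= normrM ler_pM ?f1 ?g1.
under eq_Rintegral do rewrite dotp_chord cosB.
rewrite RintegralD//; last 2 first.
- by apply: int; [exact: mC|exact: mC|exact: cos_max|exact: cos_max].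
- by apply: int; [exact: mS|exact: mS|exact: sin_max|exact: sin_max].
rewrite (Rintegral_prodM mumu P (mC _ _ _ ma) (mC _ _ _ mb) (c1 _ a) (c1 _ b)).
rewrite (Rintegral_prodM mumu P (mS _ _ _ ma) (mS _ _ _ mb) (s1 _ a) (s1 _ b)).
rewrite [X in _ + X * _]sin_transform_difference mul0r addr0.
rewrite [X in X * _]cos_transform_difference; congr (_ * _).
rewrite -{1}(ger0_norm (ltW t0)) -enorm_vscale -(uniform_sphere_cos Pw).
by apply: eq_Rintegral => p _; rewrite /= /b [in RHS]dotpC dotp_vscale dotpC.
Qed.

(** Fubini, the Gaussian being explicitly transformed: the Gaussian average of
    a Fourier transform is an integral against a concentrated Gaussian. *)
Lemma gauss_average_chord (s : R) : 0 < s ->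
  \int[lebesgue_Rn R n.+1]_xi
     (gauss_weight s xi * (spectrum mu xi * radial n (t * enorm xi))) =
  \int[Q]_q (gauss_mass s ^+ n.+1 * expR (- (s ^+ 2 * enorm (chord q) ^+ 2 / 2))).
Proof.
move=> s0; pose F (z : Rd * Om) := gauss_weight s z.1 * cos (dotp (chord z.2) z.1).
have mF : measurable_fun [set: Rd * Om] F.
  apply: measurable_funM.
    exact: (measurableT_comp (measurable_gauss_weight s (n := n.+1)) measurable_fst).
  apply: measurable_cos_dotp => //.
  exact: (measurableT_comp measurable_chord measurable_snd).
have gwM (xi : Rd) (b : R) : `|b| <= 1 ->
    `|gauss_weight s xi * b| <= `|gauss_weight s xi|.
  by move=> b1; rewrite normrM ler_piMr.
have iQ : Q.-integrable setT (EFin \o cst (1 : R)).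
  exact: finite_measure_integrable_cst.
have intF : (lebesgue_Rn R n.+1 \x Q)%E.-integrable setT (EFin \o F).
  apply: (le_integrable measurableT _ _
    (integrable_prodM (integrable_gauss_weight s0 n.+1) iQ)).
    exact/measurable_EFinP.
  by move=> z _; rewrite lee_fin /= mulr1 gwM// cos_max.
have int1 xi : Q.-integrable setT (EFin \o (fun q => cos (dotp (chord q) xi))).
  apply: (@bounded_integrable _ _ _ Q _ 1) => [|q]; last exact: cos_max.
  by apply: measurable_cos_dotp => //; exact: measurable_chord.
have int2 q : (lebesgue_Rn R n.+1).-integrable setT (EFin \o (fun xi =>
    gauss_weight s xi * cos (dotp (chord q) xi))).
  apply: (le_integrable measurableT _ _ (integrable_gauss_weight s0 n.+1)).
    apply/measurable_EFinP; apply: measurable_funM; first exact: measurable_gauss_weight.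
    exact: measurable_cos_dotp.
  by move=> xi _; rewrite lee_fin /= gwM// cos_max.
transitivity (\int[lebesgue_Rn R n.+1]_xi \int[Q]_q F (xi, q)).
  apply: eq_Rintegral => xi _; rewrite -cos_transform_chord.
  by rewrite -RintegralZl.
rewrite Rintegral_prod1//; last first.
  by move=> xi; apply: eq_integrable (integrableZl measurableT (gauss_weight s xi) (int1 xi)).
rewrite -Rintegral_prod2//.
apply: eq_Rintegral => q _; rewrite /F /=.
have := gauss_weight_transform s0 (chord q) 0.
rewrite cos0 mulr1 => <-.
by apply: eq_Rintegral => xi _; rewrite addr0.
Qed.

Lemma enorm_chord_ge q : `|edist q.1.1 q.1.2 - t| <= enorm (chord q).
Proof.
have [_ w1 _ _] := Pw.
have tw : t = Num.sqrt (\sum_i (t * coord (w q.2) i) ^+ 2).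
  under eq_bigr do rewrite exprMn.
  by rewrite -mulr_sumr sqrtrM ?sqr_ge0// sqrtr_sqr (gtr0_norm t0) -/(enorm _) w1 mulr1.
have cE i : coord (chord q) i = coord q.1.1 i - coord q.1.2 i - t * coord (w q.2) i.
  exact: coord_mktuple.
rewrite ler_norml lerBlDr lerNl opprB lerBlDr; apply/andP; split.
  rewrite [leLHS]tw.
  have := minkowski2 (fun i => - coord (chord q) i) (fun i => coord q.1.1 i - coord q.1.2 i).
  under eq_bigr do rewrite cE opprB subrK.
  by under [X in Num.sqrt X + _]eq_bigr do rewrite sqrrN.
rewrite [in leRHS]tw.
have := minkowski2 (fun i => coord (chord q) i) (fun i => t * coord (w q.2) i).
by under eq_bigr do rewrite cE subrK.
Qed.

(** Almost surely x and y lie in the support, where the chord is at least as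
    long as the gap; hence a function g decreasing from c on is at most g(c)
    there. *)
Lemma chord_gap_integral (g : R -> R) (c K : R) :
  (forall x y, measure_support mu x -> measure_support mu y ->
    c <= `|edist x y - t|) ->
  measurable_fun [set: R] g -> (forall r, 0 <= g r <= K) ->
  (forall r, c <= r -> g r <= g c) ->
  \int[Q]_q g (enorm (chord q)) <= g c.
Proof.
move=> gap mg gK gle.
have [N [mN N0 subN]] := negligible_not_support mu.
have mh : measurable_fun [set: Om] (fun q => g (enorm (chord q))).
  apply: (measurableT_comp mg).
  by apply: measurable_enorm_fun; exact: measurable_chord.
have inth : Q.-integrable setT (EFin \o (fun q => g (enorm (chord q)))).
  apply: (@bounded_integrable _ _ _ Q _ K) => // q.
  by have /andP[g0 gk] := gK (enorm (chord q)); rewrite ger0_norm.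
pose B : set (Rd * Rd) := (N `*` setT) `|` (setT `*` N).
have mNT : measurable (N `*` [set: Rd]) by exact: measurableX.
have mTN : measurable ([set: Rd] `*` N) by exact: measurableX.
have mB : measurable B by exact: measurableU.
have B0 : mumu B = 0%E.
  have B1 : mumu (N `*` setT) = 0%E.
    apply: etrans (product_measure1E mu mu mN measurableT) _.
    by rewrite [X in (X * _)%E](_ : _ = 0%E) ?mul0e.
  have B2 : mumu (setT `*` N) = 0%E.
    apply: etrans (product_measure1E mu mu measurableT mN) _.
    by rewrite [X in (_ * X)%E](_ : _ = 0%E) ?mule0.
  exact: null_set_setU.
pose A : set Om := B `*` setT.
have mA : measurable A by exact: measurableX.
have A0 : Q A = 0%E.
  have -> : Q A = (mumu B * P setT)%E.
    exact: (product_measure1E mumu P mB measurableT).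
  by rewrite B0 mul0e.
rewrite /Rintegral (negligible_integral mA measurableT inth A0) -/(Rintegral _ _ _).
have mD : measurable ([set: Om] `\` A) by exact: measurableD.
apply: (@le_trans _ _ (\int[Q]_(q in [set: Om] `\` A) g c)).
  apply: le_Rintegral => //.
  - exact: integrableS inth.
  - apply: (@integrableS _ _ _ Q setT) => //; exact: finite_measure_integrable_cst.
  - move=> [[x y] p] [_ nA]; apply: gle.
    apply: le_trans (enorm_chord_ge _); apply: gap => /=.
      apply: contrapT => nx; apply: nA; split => //; left; split => //.
      exact: subN.
    apply: contrapT => ny; apply: nA; split => //; right; split => //.
    exact: subN.
rewrite Rintegral_cst// ler_piMr//; first by have /andP[] := gK c.
rewrite -lee_fin fineK ?fin_num_measure//; exact: probability_le1.
Qed.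

End sphere_convolution.

Section vanishing.
Context {R : realType} {n : nat}.
Variable mu : probability (Rn R n.+1) R.

Lemma gauss_massE (s : R) : 0 < s -> gauss_mass s = s * Num.sqrt (pi *+ 2).
Proof.
move=> s0; have sN0 : s != 0 by rewrite gt_eqF.
have := integral_normal_pdf (0 : R) s.
rewrite normal_pdfE// => h.
have : \int[lebesgue_measure]_x (normal_peak s * normal_fun 0 s x) = 1.
  by rewrite /Rintegral h.
rewrite RintegralZl//; last exact: integrable_normal_fun.
rewrite -/(gauss_mass s) => e.
have p0 : normal_peak s != 0 by rewrite gt_eqF// normal_peak_gt0.
rewrite -[LHS](mulKf p0) e mulr1 /normal_peak invrK -mulrnAr sqrtrM ?sqr_ge0//.
by rewrite sqrtr_sqr gtr0_norm.
Qed.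

(** With y = s^2 c^2 / 2, the bound e^y >= (y/d)^d leaves (B/s)^d, where B is
    the constant below; a large s makes it small. *)
Lemma gauss_tail_small (L c e S : R) (d : nat) : (0 < d)%N ->
  0 <= L -> 0 < c -> 0 < e ->
  exists s, [/\ 0 < s, S <= s &
    (s * L) ^+ d * expR (- (s ^+ 2 * c ^+ 2 / 2)) <= e].
Proof.
move=> d0 L0 c0 e0.
pose B := 2 * d%:R * L / c ^+ 2.
have B0 : 0 <= B by rewrite /B divr_ge0 ?sqr_ge0 ?mulr_ge0 ?ler0n.
pose s := 1 + `|S| + B + B / e.
have Be0 : 0 <= B / e by rewrite divr_ge0// ltW.
have s1 : 1 <= s by rewrite /s -!addrA lerDl !addr_ge0.
have s0 : 0 < s by apply: lt_le_trans s1.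
exists s; split => //.
  rewrite (le_trans (ler_norm _))// /s addrAC -addrA.
  by have := normr_ge0 S; move: B0 Be0; lra.
have Bs : B / s <= 1 by rewrite ler_pdivrMr// mul1r /s; have := normr_ge0 S; move: Be0; lra.
have Bse : B / s <= e.
  rewrite ler_pdivrMr// -ler_pdivrMl// mulrC /s; have := normr_ge0 S; move: B0; lra.
have dN0 : d%:R != 0 :> R by rewrite pnatr_eq0 -lt0n.
pose y := s ^+ 2 * c ^+ 2 / 2.
have y0 : 0 < y by rewrite divr_gt0// mulr_gt0 ?exprn_gt0.
have yd0 : 0 < y / d%:R by rewrite divr_gt0// ltr0n.
have ey : (y / d%:R) ^+ d <= expR y.
  rewrite [X in _ <= expR X](_ : y = d%:R * (y / d%:R)); last by rewrite mulrC divfK.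
  rewrite expRM_natl lerXn2r ?nnegrE ?(ltW yd0) ?expR_ge0//.
  by rewrite (le_trans _ (expR_ge1Dx _))// lerDr.
apply: (@le_trans _ _ ((B / s) ^+ d)).
  rewrite -/y expRN ler_pdivrMr ?expR_gt0//.
  rewrite -[leLHS]mulr1; apply: le_trans (ler_wpM2l _ ey); last first.
    by rewrite exprn_ge0// divr_ge0// ltW.
  have sL0 : 0 <= s * L by rewrite mulr_ge0// ltW.
  have By0 : 0 <= B / s * (y / d%:R).
    by rewrite mulr_ge0 ?(ltW yd0)// divr_ge0// ltW.
  rewrite mulr1 -exprMn lerXn2r ?nnegrE//.
  have key (x k : R) : x != 0 -> k != 0 -> c != 0 ->
      x * L = 2 * k * L / c ^+ 2 / x * (x ^+ 2 * c ^+ 2 / 2 / k).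
    by move=> x1 k1 c1; field; rewrite k1 x1 c1.
  by rewrite le_eqVlt; apply/orP; left; apply/eqP/key; rewrite // gt_eqF.
apply: (le_trans _ Bse); rewrite -[leRHS]expr1.
by apply: ler_wiXn2l => //; rewrite divr_ge0// ltW.
Qed.

Lemma gauss_average_small (t e S : R) : 0 < t -> 0 < e ->
  measure_support mu `<=` unit_cube ->
  (forall x y, measure_support mu x -> measure_support mu y -> edist x y != t) ->
  exists s, [/\ 0 < s, S <= s &
    \int[lebesgue_Rn R n.+1]_xi
      (gauss_weight s xi * (spectrum mu xi * radial n (t * enorm xi))) <= e].
Proof.
move=> t0 e0 sub nt.
have [dT [T [P [w Pw]]]] := uniform_sphere_exists (R := R) n.
have [c c0 gap] := support_dist_gap sub nt.
have [s [s0 Ss small]] :=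
  @gauss_tail_small (Num.sqrt (pi *+ 2)) c e S n.+1 isT (sqrtr_ge0 _) c0 e0.
exists s; split => //; rewrite (gauss_average_chord mu Pw t0 s0).
pose g r := gauss_mass s ^+ n.+1 * expR (- (s ^+ 2 * r ^+ 2 / 2)).
have gm0 : 0 <= gauss_mass s by rewrite gauss_massE// mulr_ge0 ?sqrtr_ge0// ltW.
have mg : measurable_fun [set: R] g.
  apply: measurable_funM => //; apply: (measurableT_comp (@measurable_expR R)).
  apply: measurableT_comp => //; apply: measurable_funM => //.
  by apply: measurable_funM => //; exact: measurable_funX.
have gK r : 0 <= g r <= gauss_mass s ^+ n.+1.
  rewrite mulr_ge0 ?exprn_ge0 ?expR_ge0//= ler_piMr ?exprn_ge0//.
  by rewrite -expR0 ler_expR oppr_le0 divr_ge0// mulr_ge0 ?sqr_ge0.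
have gle r : c <= r -> g r <= g c.
  move=> cr; rewrite ler_wpM2l ?exprn_ge0// ler_expR lerN2 ler_wpM2r//.
  by rewrite ler_wpM2l ?sqr_ge0// lerXn2r ?nnegrE ?(le_trans _ cr) ?(ltW c0).
apply: (le_trans (chord_gap_integral Pw t0 gap mg gK gle)).
by rewrite /g gauss_massE.
Qed.

End vanishing.

(** * Balance of energies at one scale *)

Section energy.
Context {R : realType} {d : nat}.
Variable mu : probability (Rn R d) R.
Let Rd := Rn R d.
Local Notation leb := (lebesgue_Rn R d).

Definition origin_ball (T : R) : set Rd := [set xi | enorm xi <= T].

Lemma measurable_origin_ball T : measurable (origin_ball T).
Proof.
have mE : measurable_fun [set: Rd] (fun y => enorm y) by exact: measurable_enorm_fun.
have := mE measurableT _ (measurable_itv `]-oo, T]).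
by rewrite setTI; congr (measurable _); apply/seteqP; split => y /=; rewrite in_itv.
Qed.

Lemma integrable_spectrum_ball T :
  leb.-integrable (origin_ball T) (EFin \o spectrum mu).
Proof.
have mB := measurable_origin_ball T.
have ig : leb.-integrable (origin_ball T)
    (EFin \o (fun xi => expR (T ^+ 2 / 2) * gauss_weight 1 xi)).
  apply: (integrableS measurableT mB (@subsetT _ _)).
  exact: (integrableZl measurableT (expR (T ^+ 2 / 2)) (integrable_gauss_weight ltr01 d)).
apply: le_integrable ig => //.
  by apply/measurable_EFinP; apply: measurable_funTS; exact: measurable_spectrum.
move=> xi; rewrite /origin_ball /= => xiT; rewrite lee_fin.
rewrite ger0_norm ?spectrum_ge0// (le_trans (spectrum_le1 mu xi))//.
rewrite ger0_norm ?mulr_ge0 ?expR_ge0// /gauss_weight -expRD expr1n.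
rewrite -[leLHS]expR0 ler_expR.
rewrite subr_ge0 ler_wpM2r// lerXn2r ?nnegrE ?enorm_ge0//.
exact: le_trans (enorm_ge0 xi) xiT.
Qed.

Definition energy T : R := \int[leb]_(xi in origin_ball T) spectrum mu xi.

Lemma fourier_energyE T : fourier_energy mu T = (energy T)%:E.
Proof.
rewrite /energy /Rintegral fineK//; apply: integrable_fin_num.
  exact: measurable_origin_ball.
exact: integrable_spectrum_ball.
Qed.

Lemma energy_ge0 T : 0 <= energy T.
Proof. by apply: Rintegral_ge0 => xi _; exact: spectrum_ge0. Qed.

Lemma energy_annulus T1 T2 : T1 <= T2 ->
  energy T2 = energy T1 +
    \int[leb]_(xi in origin_ball T2 `\` origin_ball T1) spectrum mu xi.
Proof.
move=> T12; have m1 := measurable_origin_ball T1; have m2 := measurable_origin_ball T2.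
have sub : origin_ball T1 `<=` origin_ball T2 by move=> xi /= /le_trans; exact.
rewrite /energy -Rintegral_setU//.
- by rewrite setDUK.
- exact: measurableD.
- rewrite setDUK//; exact: integrable_spectrum_ball.
- by apply/disj_setPS => xi [] ? [].
Qed.

Lemma energy_le T1 T2 : T1 <= T2 -> energy T1 <= energy T2.
Proof.
move=> T12; rewrite (energy_annulus T12) lerDl.
by apply: Rintegral_ge0 => xi _; exact: spectrum_ge0.
Qed.

End energy.

Section one_scale.
Context {R : realType} {m : nat}.
Variable mu : probability (Rn R m.+2) R.
Let Rd := Rn R m.+2.
Local Notation leb := (lebesgue_Rn R m.+2).
Local Notation u := (radial m.+1).

(** The Gaussian average of |mu^|^2 u(t |.|) is at most e / 2 while the weight
    is at least 1 - T^2 / (2 s^2) on the inner ball, and never exceeds 1.  The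
    three frequency regions then give the inequality up to e. *)
Lemma spectrum_radial_balance (T X t dl B : R) :
  0 < T -> T <= X -> 0 < t -> t * T <= dl ->
  measure_support mu `<=` unit_cube ->
  (forall x y, measure_support mu x -> measure_support mu y -> edist x y != t) ->
  (\int[leb]_(xi in ~` origin_ball X) (spectrum mu xi * `|u (t * enorm xi)|)%:E
     <= B%:E)%E ->
  (1 - dl) * energy mu T <= 46 / 100 * (energy mu X - energy mu T) + B.
Proof.
move=> T0 TX t0 tT sub nt tailB.
set f := energy mu T; have f0 : 0 <= f := energy_ge0 mu T.
apply/ler_addgt0Pr => e e0.
have e2 : 0 < e / 2 by rewrite divr_gt0.
have [s [s0 sS small]] :=
  gauss_average_small (1 + T ^+ 2 * f / e) t0 e2 sub nt.
pose h (xi : Rd) := gauss_weight s xi * (spectrum mu xi * u (t * enorm xi)).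
have te0 (xi : Rd) : 0 <= t * enorm xi by rewrite mulr_ge0 ?enorm_ge0// ltW.
have gw0 (xi : Rd) : 0 <= gauss_weight s xi by exact: expR_ge0.
have gw1 (xi : Rd) : gauss_weight s xi <= 1.
  by rewrite -[leRHS]expR0 ler_expR oppr_le0 divr_ge0 ?mulrn_wge0 ?sqr_ge0.
have sp0 := spectrum_ge0 mu.
have mh0 : measurable_fun [set: Rd] (fun xi => u (t * enorm xi)).
  apply: (measurableT_comp (measurable_radial m.+1)).
  by apply: measurable_funM => //; exact: measurable_enorm_fun.
have mh : measurable_fun [set: Rd] h.
  apply: measurable_funM; first exact: measurable_gauss_weight.
  by apply: measurable_funM => //; exact: measurable_spectrum.
have inth : leb.-integrable setT (EFin \o h).
  apply: (le_integrable measurableT _ _ (integrable_gauss_weight s0 m.+2)).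
    exact/measurable_EFinP.
  move=> xi _; rewrite lee_fin /= /h normrM ler_piMr// normrM (ger0_norm (sp0 xi)).
  by rewrite mulr_ile1// ?spectrum_le1// radial_norm_le1.
pose BT : set Rd := origin_ball T; pose BX : set Rd := origin_ball X.
have mBT : measurable BT := measurable_origin_ball T.
have mBX : measurable BX := measurable_origin_ball X.
have mA : measurable (BX `\` BT) by exact: measurableD.
have mO : measurable (~` BX) by exact: measurableC.
have intS (D : set Rd) : measurable D -> leb.-integrable D (EFin \o h).
  by move=> mD; exact: integrableS inth.
have subBX : BT `<=` BX by move=> xi /= /le_trans; exact.
have split3 : \int[leb]_xi h xi = \int[leb]_(xi in BT) h xi +
    \int[leb]_(xi in BX `\` BT) h xi + \int[leb]_(xi in ~` BX) h xi.
  rewrite -(Rintegral_setU mBT mA).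
  - rewrite setDUK// -(Rintegral_setU mBX mO) ?setUv//.
    by apply/disj_setPS => xi [].
  - by rewrite setDUK//; exact: intS mBX.
  - by apply/disj_setPS => xi [] ? [].
have low : (1 - dl - T ^+ 2 / (2 * s ^+ 2)) * f <= \int[leb]_(xi in BT) h xi.
  rewrite /f /energy -RintegralZl//; last exact: integrable_spectrum_ball.
  apply: le_Rintegral => //.
  - exact: (integrableZl mBT _ (integrable_spectrum_ball mu T)).
  - exact: intS.
  move=> xi xiT; rewrite /h [leRHS]mulrCA [leRHS]mulrC ler_wpM2r//.
  have xiT' : enorm xi <= T := xiT.
  have g1 : 1 - T ^+ 2 / (2 * s ^+ 2) <= gauss_weight s xi.
    apply: le_trans (expR_ge1Dx _); rewrite lerD2l lerN2 -mulr_natl.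
    rewrite ler_wpM2r ?invr_ge0 ?mulr_ge0 ?ler0n ?(ltW s0)//.
    by rewrite lerXn2r ?nnegrE ?enorm_ge0// ltW.
  have u1 : 1 - dl <= u (t * enorm xi).
    apply: le_trans (radial_ge_sub m.+1 (te0 xi)).
    by rewrite lerD2l lerN2 (le_trans _ tT)// ler_wpM2l// ltW.
  have := gw1 xi; have := radial_norm_le1 m.+1 (te0 xi).
  rewrite ler_norml => /andP[_].
  move: g1 u1; move: (gauss_weight s xi) (u _) (_ / _) => g v a; clear; nra.
have intA : leb.-integrable (BX `\` BT) (EFin \o spectrum mu).
  apply: (integrableS mBX mA); last exact: integrable_spectrum_ball.
  by move=> xi [].
have mid : - (46 / 100 * (energy mu X - f)) <= \int[leb]_(xi in BX `\` BT) h xi.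
  rewrite /f (energy_annulus mu TX) addrAC subrr add0r -mulNr -RintegralZl//.
  apply: le_Rintegral => //.
  - exact: (integrableZl mA _ intA).
  - exact: intS.
  move=> xi _; rewrite /h [leRHS]mulrCA [leRHS]mulrC ler_wpM2r//.
  have := radial_ge m (te0 xi).
  have := gw0 xi; have := gw1 xi; move: (gauss_weight s xi) (u _) => g v; clear; nra.
have out : - B <= \int[leb]_(xi in ~` BX) h xi.
  rewrite lerNl (le_trans (ler_norm _))// normrN.
  apply: (le_trans (le_normr_Rintegral mO (intS _ mO))).
  rewrite -lee_fin /Rintegral fineK; last first.
    exact: (integrable_fin_num mO (integrable_abse (intS _ mO))).
  apply: le_trans tailB; apply: ge0_le_integral => //.
  - apply/measurable_EFinP; apply: measurable_funTS; exact: measurableT_comp.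
  - apply/measurable_EFinP; apply: measurable_funTS; apply: measurable_funM.
      exact: measurable_spectrum.
    exact: measurableT_comp.
  - move=> xi _; rewrite lee_fin normrM (ger0_norm (gw0 xi)) normrM.
    by rewrite (ger0_norm (sp0 xi)); apply: ler_piMl; [exact: mulr_ge0|exact: gw1].
have smallh : \int[leb]_xi h xi <= e / 2 by exact: small.
have eta : T ^+ 2 / (2 * s ^+ 2) * f <= e / 2.
  have q0 : 0 <= T ^+ 2 * f / e by rewrite divr_ge0 ?mulr_ge0 ?sqr_ge0// ltW.
  have s1 : 1 <= s by rewrite (le_trans _ sS)// lerDl.
  have : T ^+ 2 * f <= e * s ^+ 2.
    rewrite -ler_pdivrMl// mulrC; apply: (@le_trans _ _ s).
      by apply: le_trans sS; rewrite lerDr.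
    by rewrite expr2 ler_peMl// ltW.
  move=> h1; rewrite mulrAC ler_pdivrMr ?mulr_gt0 ?exprn_gt0//.
  by rewrite (_ : e / 2 * (2 * s ^+ 2) = e * s ^+ 2)//; field.
rewrite split3 in smallh.
move: smallh low mid out eta.
move: (Rintegral _ _ _) (Rintegral _ _ _) (Rintegral _ _ _) (_ / (2 * _)) => i1 i2 i3 a.
clear; lra.
Qed.

End one_scale.

Section tail.
Context {R : realType} {m : nat}.
Variable mu : probability (Rn R m.+2) R.
Let Rd := Rn R m.+2.
Local Notation leb := (lebesgue_Rn R m.+2).
Local Notation u := (radial m.+1).
Local Notation beta := (m.+1%:R / 2 : R).

Lemma radial_decay_powR (K r : R) : 0 < r ->
  u r ^+ 2 * r ^+ m.+1 <= K -> `|u r| <= Num.sqrt K / r `^ beta.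
Proof.
move=> r0 uK; have rb : 0 < r `^ beta by exact: powR_gt0.
rewrite ler_pdivlMr// -[leLHS]ger0_norm ?mulr_ge0 ?powR_ge0//.
rewrite -sqrtr_sqr ler_wsqrtr// exprMn real_normK ?num_real//.
by rewrite -[(r `^ _) ^+ 2]powR_mulrn ?powR_ge0// -powRrM divfK// powR_mulrn// ltW.
Qed.

(** On the k-th shell, of radii up to 2^(k+1) p^2 T, the radial function is at
    most L (2^k p)^(-beta) and the energy at most (2^(k+1) p^2)^c times that of
    the ball of radius T.  The products form a geometric series of ratio
    2^(c - beta), with first term of order p^(2c - beta). *)
Lemma dyadic_radial_tail (L c p T : R) :
  0 <= L -> 0 < c -> c < beta -> 1 <= p -> 0 < T ->
  (forall r, p <= r -> `|u r| <= L / r `^ beta) ->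
  (forall k, energy mu (2 ^+ k.+1 * p ^+ 2 * T) <=
             (2 ^+ k.+1 * p ^+ 2) `^ c * energy mu T) ->
  (\int[leb]_(xi in ~` origin_ball (p ^+ 2 * T))
     (spectrum mu xi * `|u (p^-1 / T * enorm xi)|)%:E <=
   (L * 2 `^ c / (1 - 2 `^ (c - beta)) / p `^ (beta - 2 * c) * energy mu T)%:E)%E.
Proof.
move=> L0 c0 cb p1 T0 decay growth.
have p0 : 0 < p by apply: lt_le_trans p1.
set X := p ^+ 2 * T; have X0 : 0 < X by rewrite mulr_gt0 ?exprn_gt0.
pose C k : R := L / (2 ^+ k * p) `^ beta.
have C0 k : 0 <= C k by rewrite divr_ge0 ?powR_ge0.
pose Bk k : set Rd := origin_ball (2 ^+ k.+1 * X).
have mBk k : measurable (Bk k) := measurable_origin_ball _.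
pose f k := (fun xi : Rd => (C k * spectrum mu xi)%:E) \_ (Bk k).
have f0 k xi : [set: Rd] xi -> (0 <= f k xi)%E.
  move=> _; rewrite /f patchE; case: ifPn => // _.
  by rewrite lee_fin mulr_ge0 ?spectrum_ge0.
have mf k : measurable_fun [set: Rd] (f k).
  apply: (measurable_restrictT _ (mBk k)).1; apply: measurable_funTS.
  apply/measurable_EFinP; apply: measurable_funM => //; exact: measurable_spectrum.
have point_le xi : (~` origin_ball X) xi ->
    ((spectrum mu xi * `|u (p^-1 / T * enorm xi)|)%:E <= \sum_(k <oo) f k xi)%E.
  move=> /negP; rewrite -ltNge => Xxi.
  have [k xik] : exists k, 2 ^+ k * X < enorm xi <= 2 ^+ k.+1 * X.
    have ex : exists N : nat, enorm xi <= 2 ^+ N * X.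
      exists (Num.bound (enorm xi / X)); rewrite -ler_pdivrMr//.
      have xX0 : 0 <= enorm xi / X by rewrite divr_ge0 ?enorm_ge0// ltW.
      have := archi_boundP xX0 => /ltW /le_trans; apply.
      by rewrite -natrX ler_nat ltnW// ltn_expl.
    case: (ex_minnP ex) => -[|k]; first by rewrite expr0 mul1r leNgt Xxi.
    move=> kle kmin; exists k; rewrite kle andbT ltNge; apply/negP => /kmin.
    by rewrite ltnn.
  have /andP[k1 k2] := xik.
  apply: (@le_trans _ _ (f k xi)); last first.
    have := @nneseries_lim_ge R (fun k => f k xi) xpredT 0 k.+1 (fun n _ _ => f0 n xi I).
    apply: le_trans; rewrite big_nat_recr//= leeDr//.
    by apply: sume_ge0 => i _; exact: f0.
  rewrite /f patchE mem_set// lee_fin mulrC ler_wpM2r ?spectrum_ge0//.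
  have arg : 2 ^+ k * p <= p^-1 / T * enorm xi.
    have -> : 2 ^+ k * p = p^-1 / T * (2 ^+ k * X).
      by rewrite /X; field; rewrite !gt_eqF.
    by rewrite ler_wpM2l ?(ltW k1)// divr_ge0 ?invr_ge0 ?(ltW p0) ?(ltW T0).
  have kp0 : 0 < 2 ^+ k * p by rewrite mulr_gt0// exprn_gt0.
  have parg : p <= p^-1 / T * enorm xi.
    by apply: le_trans arg; rewrite ler_peMl ?(ltW p0)// exprn_ege1// ler1n.
  apply: (le_trans (decay _ parg)); rewrite ler_wpM2l// lef_pV2 ?posrE ?powR_gt0//.
    by rewrite ge0_ler_powR ?nnegrE ?(ltW kp0) ?(le_trans (ltW p0) parg)// divr_ge0.
  exact: lt_le_trans parg.
apply: (@le_trans _ _ (\int[leb]_xi \sum_(k <oo) f k xi)%E).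
  have mO : measurable (~` origin_ball X : set Rd).
    by apply: measurableC; exact: measurable_origin_ball.
  have ms : measurable_fun [set: Rd] (fun xi => \sum_(k <oo) f k xi)%E.
    by apply: ge0_emeasurable_sum => // k xi _ _; exact: f0.
  apply: (@le_trans _ _ (\int[leb]_(xi in ~` origin_ball X) \sum_(k <oo) f k xi)%E).
    apply: ge0_le_integral => //.
    - by move=> xi _; rewrite lee_fin mulr_ge0 ?spectrum_ge0.
    - apply/measurable_EFinP; apply: measurable_funTS; apply: measurable_funM.
        exact: measurable_spectrum.
      apply: measurableT_comp => //; apply: (measurableT_comp (measurable_radial m.+1)).
      by apply: measurable_funM => //; exact: measurable_enorm_fun.
    - exact: measurable_funTS.
  apply: ge0_subset_integral => // xi _.
  by apply: nneseries_ge0 => k _ _; exact: f0.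
rewrite integral_nneseries//.
have intf k : (\int[leb]_xi f k xi = (C k * energy mu (2 ^+ k.+1 * X))%:E)%E.
  rewrite -integral_mkcond -[LHS]fineK; last first.
    apply: integrable_fin_num => //.
    exact: (integrableZl (mBk k) _ (integrable_spectrum_ball mu _)).
  by rewrite -/(Rintegral _ _ _) RintegralZl//; exact: integrable_spectrum_ball.
apply: lime_le.
  by apply: is_cvg_nneseries => k _ _; apply: integral_ge0 => xi; exact: f0.
apply: nearW => N; under eq_bigr do rewrite intf.
rewrite sumEFin lee_fin.
pose q := 2 `^ (c - beta).
have pN0 : p != 0 by rewrite gt_eqF.
have q0 : 0 <= q by exact: powR_ge0.
have q1 : q < 1.
  rewrite /q /powR gt_eqF// -[ltRHS]expR0 ltr_expR pmulr_llt0 ?subr_lt0//.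
  by rewrite ln_gt0// ltr1n.
pose A := L * 2 `^ c / p `^ (beta - 2 * c) * energy mu T.
have A0 : 0 <= A by rewrite mulr_ge0 ?energy_ge0// divr_ge0 ?mulr_ge0 ?powR_ge0.
have term k : C k * energy mu (2 ^+ k.+1 * X) <= A * q ^+ k.
  have := growth k; rewrite -/X -mulrA -/X => gk.
  apply: (le_trans (ler_wpM2l (C0 k) gk)).
  have e1 x : (2 ^+ k) `^ x = (2 `^ x) ^+ k :> R.
    by rewrite -(powR_mulrn k (ler0n R 2)) powRAC powR_mulrn ?powR_ge0.
  rewrite /C powRM ?exprn_ge0 ?(ltW p0)// powRM ?exprn_ge0 ?mulr_ge0 ?(ltW p0)//.
  rewrite exprS powRM ?exprn_ge0// !e1.
  have -> : (p ^+ 2) `^ c = p `^ (2 * c).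
    by rewrite -(powR_mulrn 2 (ltW p0)) -powRrM.
  rewrite /A /q !powRB ?pN0 ?implybT ?pnatr_eq0 ?implybT// expr_div_n.
  have b0 : (2 `^ beta) ^+ k != 0 :> R by rewrite expf_neq0// gt_eqF ?powR_gt0.
  have pb0 : p `^ beta != 0 by rewrite gt_eqF ?powR_gt0.
  have pc0 : p `^ (2 * c) != 0 by rewrite gt_eqF ?powR_gt0.
  rewrite le_eqVlt; apply/orP; left; apply/eqP; field.
  by rewrite b0 pb0 pc0.
apply: (@le_trans _ _ (\sum_(0 <= k < N) A * q ^+ k)); first exact: ler_sum.
rewrite -mulr_sumr.
have geo : \sum_(0 <= k < N) q ^+ k <= (1 - q)^-1.
  rewrite big_mkord -[leRHS]mul1r ler_pdivlMr ?subr_gt0// mulrC.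
  have := subrX1 q N; rewrite -opprB -[in RHS]opprB mulNr => /oppr_inj <-.
  by rewrite gerBl exprn_ge0.
apply: (le_trans (ler_wpM2l A0 geo)); rewrite /A -/q.
by rewrite le_eqVlt; apply/orP; left; apply/eqP; ring.
Qed.

End tail.

(** * Scales whose distance is missing *)

Section no_distance.
Context {R : realType} {m : nat}.
Local Notation beta := (m.+1%:R / 2 : R).

(** Here p stands for 1 / delta.  Both errors, delta in the inner ball and
    the tail, are made at most 1/50, leaving 1 - 2/50 = 96/100. *)
Lemma energy_gain_of_missing_distance (c T0 : R) : 0 < c -> 2 * c < beta ->
  1 <= T0 ->
  exists P0 : R, 1 <= P0 /\ forall (mu : probability (Rn R m.+2) R) (p T : R),
    P0 <= p -> T0 <= T ->
    measure_support mu `<=` unit_cube ->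
    (forall x y, measure_support mu x -> measure_support mu y ->
      edist x y != p^-1 / T) ->
    (forall T1 T2 : R, T0 <= T1 -> T0 <= T2 ->
      energy mu (T1 * T2) <= T1 `^ c * energy mu T2) ->
    96 / 100 * energy mu T <= 46 / 100 * (energy mu (p ^+ 2 * T) - energy mu T).
Proof.
move=> c0 c2 T01.
have [K [K0 decay]] := radial_decay (R := R) m.
pose L := Num.sqrt K; have L0 : 0 <= L by exact: sqrtr_ge0.
have cb : c < beta by move: c0 c2; clear; lra.
pose B := L * 2 `^ c / (1 - 2 `^ (c - beta)).
have q1 : 2 `^ (c - beta) < 1 :> R.
  rewrite /powR gt_eqF// -[ltRHS]expR0 ltr_expR pmulr_llt0 ?subr_lt0//.
  by rewrite ln_gt0// ltr1n.
have B0 : 0 <= B by rewrite divr_ge0 ?mulr_ge0 ?powR_ge0// subr_ge0 ltW.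
have g0 : 0 < beta - 2 * c by rewrite subr_gt0.
pose r0 : R := 2 * m.+1%:R + 1; have r00 : 0 <= r0 by rewrite addr_ge0 ?mulr_ge0.
pose V := (50 * B + 1) `^ (beta - 2 * c)^-1; have V0 : 0 <= V := powR_ge0 _ _.
exists (50 + r0 + T0 + V); split; first by move: r00 T01 V0; clear; lra.
move=> mu p T pP TT0 sub nt growth.
have p50 : 50 <= p by move: r00 T01 V0 pP; clear; lra.
have pr0 : r0 <= p by move: r00 T01 V0 pP; clear; lra.
have pT0 : T0 <= p by move: r00 T01 V0 pP; clear; lra.
have pV : V <= p by move: r00 T01 V0 pP; clear; lra.
have p1 : 1 <= p by move: p50; clear; lra.
have p0 : 0 < p by move: p50; clear; lra.
have T_gt0 : 0 < T by move: T01 TT0; clear; lra.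
have dec r : p <= r -> `|radial m.+1 r| <= L / r `^ beta.
  move=> pr; apply: radial_decay_powR; first exact: lt_le_trans pr.
  by apply: decay; exact: le_trans pr.
have gr k : energy mu (2 ^+ k.+1 * p ^+ 2 * T) <=
             (2 ^+ k.+1 * p ^+ 2) `^ c * energy mu T.
  apply: growth => //; apply: (le_trans pT0); apply: (@le_trans _ _ (p ^+ 2)).
    by rewrite expr2 ler_peMl// ltW.
  by rewrite ler_peMl ?sqr_ge0// exprn_ege1// ler1n.
have tail := dyadic_radial_tail L0 c0 cb p1 T_gt0 dec gr.
have TX : T <= p ^+ 2 * T by rewrite ler_peMl ?(ltW T_gt0)// exprn_ege1.
have t0 : 0 < p^-1 / T by rewrite divr_gt0 ?invr_gt0.
have tT : p^-1 / T * T <= p^-1 by rewrite divfK// gt_eqF.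
have := spectrum_radial_balance T_gt0 TX t0 tT sub nt tail.
rewrite -/B.
have pB : B / p `^ (beta - 2 * c) <= 1 / 50.
  rewrite ler_pdivrMr ?powR_gt0//.
  have : V `^ (beta - 2 * c) <= p `^ (beta - 2 * c).
    by rewrite ge0_ler_powR ?nnegrE ?(ltW g0) ?(ltW p0).
  rewrite /V -powRrM mulVf ?gt_eqF// powRr1; last by move: B0; clear; lra.
  by move: B0; clear; lra.
have dp : p^-1 <= 1 / 50 by rewrite mul1r lef_pV2 ?posrE.
have f0 := energy_ge0 mu T.
have h1 := ler_wpM2r f0 pB; have h2 := ler_wpM2r f0 dp.
by move: h1 h2; clear; lra.
Qed.

End no_distance.

(** Telescoping, with the subtracted terms a_(j+1) absorbing the b_j. *)
Lemma sum_gain_le (R : realDomainType) (a b : nat -> R) (J : nat) :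
  (forall j, (1 <= j <= J.-1)%N -> b j <= a j.+1) ->
  (forall j, 0 <= a j) -> (1 <= J)%N ->
  \sum_(1 <= j < J.+1) (b j - a j) <= b J.
Proof.
move=> ba a0 J1.
have H k : (k < J)%N -> \sum_(1 <= j < k.+2) (b j - a j) <= b k.+1.
  elim: k => [|k IH] kJ; first by rewrite big_nat1 gerBl.
  rewrite big_nat_recr//=; apply: (le_trans (lerD (IH (ltnW kJ)) (lexx _))).
  have := ba k.+1; rewrite /= -ltnS (prednK J1) => /(_ kJ).
  by lra.
by have := H J.-1; rewrite (prednK J1); apply.
Qed.

Theorem theorem1p7 (R : realType) (d : nat) (hd : (2 <= d)%N)
    (c : R) (hc : 0 < c < (d%:R - 1) / 4)
    (T0 : R) (hT0 : 1 <= T0) (M : R) (hM : 4 <= M) :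
  exists deltaM : R, 0 < deltaM /\
  forall (mu : probability (Rn R d) R) (E : set (Rn R d)),
    E `<=` unit_cube ->
    measure_support mu `<=` E ->
    (forall T1 T2 : R, T0 <= T1 -> T0 <= T2 ->
      (fourier_energy mu (T1 * T2)%R <=
         (T1 `^ c)%:E * fourier_energy mu T2)%E) ->
    forall (delta : R) (J : nat) (r : nat -> R),
      0 < delta < deltaM ->
      (1 <= J)%N ->
      (forall j : nat, (1 <= j <= J)%N -> T0 < r j) ->
      (forall j : nat, (1 <= j <= J.-1)%N -> delta ^- 2 * r j <= r j.+1) ->
      ((1 - 2 / M)%:E * fourier_energy mu (delta ^- 2 * r J)%R <
         \sum_(1 <= j < J.+1) fourier_energy mu (r j))%E ->
      exists j : nat, (1 <= j <= J)%N /\ distance_set E (delta / r j).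
Proof.
have [m dE] : exists m, d = m.+2 by exists d.-2; clear -hd; case: d hd => [|[|]].
subst d; have /andP[c0 c4] := hc.
have c2 : 2 * c < m.+1%:R / 2.
  by move: c4; rewrite -[m.+2%:R]natr1; lra.
have [P0 [P01 gain]] := energy_gain_of_missing_distance c0 c2 hT0.
have P0_gt0 : 0 < P0 by apply: lt_le_trans P01.
exists P0^-1; split; first by rewrite invr_gt0.
move=> mu E Ecube suppE growth delta J r /andP[d0 dM] J1 rT0 rstep big.
apply: contrapT => none.
have pP : P0 <= delta^-1.
  by rewrite -[P0]invrK lef_pV2 ?posrE ?invr_gt0// ltW.
pose a j := energy mu (r j); pose b j := energy mu (delta ^- 2 * r j).
have gainj j : (1 <= j <= J)%N -> 96 / 100 * a j <= 46 / 100 * (b j - a j).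
  move=> jJ; rewrite /a /b -exprVn; apply: gain => //.
  - exact/ltW/rT0.
  - exact: subset_trans suppE Ecube.
  - move=> x y sx sy; apply/eqP => xy; apply: none; exists j; split => //.
    exists x, y; split; [exact: suppE|exact: suppE|].
    by rewrite xy invrK.
  - move=> T1 T2 T1T T2T; have := growth T1 T2 T1T T2T.
    by rewrite !fourier_energyE -EFinM lee_fin.
have ba j : (1 <= j <= J.-1)%N -> b j <= a j.+1.
  by move=> /rstep; exact: energy_le.
have a0 j : 0 <= a j := energy_ge0 mu (r j).
have b0 := energy_ge0 mu (delta ^- 2 * r J).
have sumba := sum_gain_le ba a0 J1.
have sumgain : 96 / 100 * \sum_(1 <= j < J.+1) a j <=
    46 / 100 * \sum_(1 <= j < J.+1) (b j - a j).
  rewrite !mulr_sumr; apply: ler_sum_nat => j /andP[j1 jJ].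
  by apply: gainj; rewrite j1 -ltnS.
move: big; rewrite fourier_energyE -EFinM.
under eq_bigr do rewrite fourier_energyE.
rewrite sumEFin lte_fin -/(b J).
have M2 : 2 / M <= 1 / 2 by rewrite ler_pdivrMr; move: hM; clear; lra.
have h := ler_wpM2r b0 M2.
move: sumba sumgain h b0; rewrite -/(b J).
change (energy mu (delta ^- 2 * r J)) with (b J).
change (\sum_(1 <= j < J.+1) energy mu (r j)) with (\sum_(1 <= j < J.+1) a j).
move: (\sum_(1 <= j < J.+1) (b j - a j)) (\sum_(1 <= j < J.+1) a j).
move: (b J) (2 / M) => bJ x Sba Sa; clear; lra.
Qed.
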